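(* Let $N=32\cdot2^t$ with $t\ge0$ an integer, and let $n$ be an integer with $17N/64\le n\le 5N/16$. Then every minimum aberration design with $N$ runs and $n$ factors (i.e. every design having minimum aberration among all two-level regular designs with $N$ runs and $n$ factors) must be, up to isomorphism, a projection of the maximal regular design of resolution IV with $N$ runs and $5N/16$ factors (constructed by doubling as in the context).
   Context: Two-level regular design: a matrix with entries $0,1$ having $N=2^k$ rows (runs) and $n$ columns (factors) whose rows, up to order, are $(\langle a_1,x\rangle,\dots,\langle a_n,x\rangle)$, $x\in\mathbb{F}_2^k$, for some $a_1,\dots,a_n\in\mathbb{F}_2^k$. A defining word of length $i\ge1$ is a set of $i$ columns whose sum is the zero vector mod 2. $A_i(D)$ is the number of defining words of length $i$ of $D$. The design $D$ has minimum aberration within a class of designs with the same numbers of runs and factors if it sequentially minimizes $A_1,A_2,\dots,A_n$ over the class, i.e. its vector $(A_1,\dots,A_n)$ is lexicographically smallest. Designs are considered up to isomorphism (permutation of rows and of columns). Doubling: the double of a $0/1$ matrix $Y$ is $\begin{pmatrix} Y & Y \\ Y & Y+1 \end{pmatrix}$ (mod 2). The maximal regular design of resolution IV with $N=32\cdot2^t=16\cdot 2^{t+1}$ runs and $5N/16$ factors is obtained by doubling, $t+1$ times, the $16\times5$ regular design defined by $I=ABCDE$, whose rows are the 16 vectors of $\mathbb{F}_2^5$ of even weight. A projection of a design is the submatrix formed by a subset of its columns (all rows retained). *)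

(* Defs.v *)
From HB Require Import structures.
From mathcomp Require Import all_boot all_order all_algebra.

Set Implicit Arguments.
Unset Strict Implicit.
Unset Printing Implicit Defensive.

Import Order.TTheory GRing.Theory.
Local Open Scope ring_scope.

(* A design with N runs and n factors is a matrix D : 'M['F_2]_(N, n).        *)

(* Bijectivity of x forces N = 2 ^ k and lists every vector of F_2^k exactly  *)
(* once; the a j need be neither distinct, nor nonzero, nor spanning.         *)
Definition regular (N n : nat) (D : 'M['F_2]_(N, n)) : Prop :=
  exists (k : nat) (a : 'I_n -> 'rV['F_2]_k) (x : 'I_N -> 'rV['F_2]_k),
    bijective x /\ forall i j, D i j = \sum_(l < k) a j 0 l * x i 0 l.

Definition defining_word (N n : nat) (D : 'M['F_2]_(N, n)) (S : {set 'I_n}) :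
  bool := (S != set0) && (\sum_(j in S) col j D == 0).

Definition num_words (N n : nat) (D : 'M['F_2]_(N, n)) (i : nat) : nat :=
  #|[set S : {set 'I_n} | defining_word D S & #|S| == i]|.

(* (A_1, ..., A_n): the entry of index i : 'I_n is A_(i + 1). The type        *)
(* carries the lexicographic order.                                           *)
Definition wordlength_pattern (N n : nat) (D : 'M['F_2]_(N, n)) :
  n.-tuplelexi nat := [tuple num_words D i.+1 | i < n].

Definition minimum_aberration (N n : nat) (D : 'M['F_2]_(N, n)) : Prop :=
  regular D /\
  forall D' : 'M['F_2]_(N, n), regular D' ->
    (wordlength_pattern D <= wordlength_pattern D')%O.

(* N, N' and n, n' may be different expressions for the same numbers; the     *)
(* bijections force N = N' and n = n'.                                        *)
Definition design_iso (N n N' n' : nat)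
    (D : 'M['F_2]_(N, n)) (D' : 'M['F_2]_(N', n')) : Prop :=
  exists (r : 'I_N -> 'I_N') (c : 'I_n -> 'I_n'),
    [/\ bijective r, bijective c & forall i j, D i j = D' (r i) (c j)].

Definition projection (N n : nat) (D : 'M['F_2]_(N, n)) (S : {set 'I_n}) :
  'M['F_2]_(N, #|S|) := colsub (@enum_val _ (mem S)) D.

Definition double_design (N n : nat) (Y : 'M['F_2]_(N, n)) :
  'M['F_2]_(N + N, n + n) := block_mx Y Y Y (Y + const_mx 1).

Lemma muln_exp2S (m s : nat) : (m * 2 ^ s + m * 2 ^ s = m * 2 ^ s.+1)%N.
Proof. by rewrite addnn -muln2 -mulnA expnSr. Qed.

Fixpoint iter_double (s N n : nat) (Y : 'M['F_2]_(N, n)) :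
  'M['F_2]_((N * 2 ^ s)%N, (n * 2 ^ s)%N) :=
  match s with
  | 0 => castmx (esym (muln1 N), esym (muln1 n)) Y
  | s'.+1 => castmx (muln_exp2S N s', muln_exp2S n s')
                    (double_design (iter_double s' Y))
  end.

Definition even_vectors : {set 'rV['F_2]_5} :=
  [set v : 'rV['F_2]_5 | ~~ odd #|[set j | v 0 j != 0]|].

Lemma sum_F2 (n : nat) (v : 'rV['F_2]_n) :
  \sum_j v 0 j = (odd #|[set j | v 0 j != 0]|)%:R.
Proof.
have vE j : v 0 j = (v 0 j != 0)%:R.
  by case: (v 0 j) => [[|[|//]] ?]; apply/val_inj.
have nE m : m%:R = (odd m)%:R :> 'F_2.
  by apply/val_inj; rewrite /= !val_Fp_nat // !modn2 oddb.
by rewrite (eq_bigr _ (fun j _ => vE j)) -natr_sum -big_mkcond sum1dep_card -nE.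
Qed.

Lemma mem_even_vectors (v : 'rV['F_2]_5) :
  (v \in even_vectors) = (\sum_j v 0 j == 0).
Proof. by rewrite inE sum_F2; case: odd. Qed.

Lemma card_even_vectors : #|even_vectors| = 16.
Proof.
pose f (u : 'rV['F_2]_4) : 'rV['F_2]_(4 + 1) := row_mx u (\sum_j u 0 j)%:M.
have f_inj : injective f by move=> u v /eq_row_mx[].
have sum_f u w : \sum_j (row_mx u w : 'rV['F_2]_(4 + 1)) 0 j =
    \sum_j u 0 j + w 0 0.
  rewrite big_split_ord big_ord1 /= row_mxEr; congr (_ + _).
  by apply: eq_bigr => j _; rewrite row_mxEl.
have addF2 (a : 'F_2) : a + a = 0 by rewrite -mulr2n -mulr_natl pchar_Zp ?mul0r.
rewrite -[RHS](_ : #|[set: 'rV['F_2]_4]| = 16)%N; last by rewrite cardsT card_mx card_Fp.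
rewrite -(card_imset _ f_inj); congr #|pred_of_set _|; apply/setP => v.
rewrite mem_even_vectors; apply/eqP/imsetP => [sv | [u _ ->]].
  pose w : 'rV['F_2]_(4 + 1) := v; pose u := lsubmx w.
  have wE : w = row_mx u (rsubmx w) by rewrite hsubmxK.
  exists u => //; rewrite -[LHS]/w [LHS]wE /f; congr (row_mx u _).
  apply/matrixP => i j; rewrite !ord1 [RHS]mxE eqxx mulr1n.
  apply: (addrI (\sum_j u 0 j)); rewrite addF2 -[RHS]sv.
  by rewrite -[v]/w [in RHS]wE (sum_f u _).
by rewrite (sum_f _ _) mxE eqxx mulr1n addF2.
Qed.

(* The order of the runs is whatever enum_val gives; designs are considered   *)
(* up to permutation of rows.                                                 *)
Definition even_design : 'M['F_2]_(16, 5) :=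
  \matrix_(i < 16) enum_val (cast_ord (esym card_even_vectors) i).

(* N = 32 * 2 ^ t = 16 * 2 ^ t.+1 runs and 5 * 2 ^ t.+1 = 5 N / 16 factors.   *)
Definition max_resIV_design (t : nat) :
  'M['F_2]_((16 * 2 ^ t.+1)%N, (5 * 2 ^ t.+1)%N) :=
  iter_double t.+1 even_design.

(* Main.v *)
Require Import Defs.
From HB Require Import structures.
From Stdlib Require Import NArith ZArith Lia.
From mathcomp Require Import all_boot all_order all_algebra.
From mathcomp Require Import zify ring.

(* Write G = F_2^k and N = 2^k. The words of a regular design are the sets of *)
(* columns a_j in G with sum 0. A projection of the reference design has      *)
(* A_1 = A_2 = A_3 = 0, so the columns of a minimum aberration design form a  *)
(* sum-free set S, and S has the fewest 4-subsets of sum 0 (equivalently, the *)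
(* least additive energy) among the sum-free sets with n elements.            *)
(*   If no five elements of S sum to 0, then S + S is disjoint from its       *)
(* translates by S, so |S + S| <= N / 2 and by Cauchy-Schwarz the energy is   *)
(* at least 2 n^4 / N, which is more than that of a good projection of the    *)
(* reference design. Hence S contains e_1, ..., e_5 with sum 0; they generate *)
(* a group V of order 16, each coset of which meets S in at most 5 points.    *)
(*   Let T be a maximal sum-free set containing S and X the set of the g such *)
(* that all g + e_i are in T. If some g in X were a sum of three elements of  *)
(* T, then T would have density at most 33 / 128 < 17 / 64. So T and T + g    *)
(* have a sum-free union, X is the stabiliser of T, and counting T in the     *)
(* cosets of V gives |T| <= N / 4 + |X|; thus V + X has index 1, 2 or 4.      *)
(*   For index 1, T is contained in a preimage of the pentagon {e_i}. For     *)
(* index 2 or 4, T is the preimage of a set of 9 points of F_2^5 or of 17     *)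
(* points of F_2^6, and a finite verification shows that it is contained in a *)
(* preimage of the pentagon or that S has too many words of length 4.         *)

(** [energy_words4] makes the additive energy an affine function of the number of 4-words among sets
    of a given size, so the two can be exchanged throughout. Deleting points greedily from the
    reference set bounds the words of a minimal [S] ([words4_subset], [words4_min]); this is
    incompatible with [energy_no_pentagon], whence [exists_pentagon].

    The slices of a maximal [T] by cosets of V are independent sets of the Clebsch graph. They have
    at most five points, and a slice with five is a vertex neighbourhood, which yields an element of
    X ([size_slice]). Thus X pays for the excess of the density over 1/4, and |X| >= |G| / 64
    ([shifts_dens]). That X stabilises [T] ([addS_shifts]) rests on a weighted covering bound for
    four independent sets ([sum_weight]).

    If V + X is everything, [pent_map_index1] concludes. In index 2 the exceptional [T] leaves [S]
    with too many words ([index2_contra]); in index 4 it equals [S] and is beaten by the preimage of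
    [pent17]. What remains is a homomorphism onto F_2^4 sending [S] into the pentagon; an invertible
    matrix realises it as the last four coordinates ([pent_map_matrix]), where [pent_coords_iter]
    finds all the needed columns in the reference design. *)

Set Implicit Arguments.
Unset Strict Implicit.
Unset Printing Implicit Defensive.

Import Order.TTheory GRing.Theory.
Local Open Scope ring_scope.

(** * Binary codes, preimages and additive energy *)

(* A vector with coordinates c_0, ..., c_(d-1) is encoded by the number with  *)
(* these binary digits, so that addition becomes [N.lxor].                    *)
Definition codes (d : nat) : seq N := [seq N.of_nat i | i <- iota 0 (2 ^ d)].

Lemma codes_uniq d : uniq (codes d).
Proof. by rewrite map_inj_uniq ?iota_uniq // => i j; lia. Qed.

Lemma mem_codes d (c : N) : (c \in codes d) = (N.to_nat c < 2 ^ d)%N.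
Proof.
apply/mapP/idP => [[i + ->]|lt_c]; first by rewrite mem_iota Nat2N.id.
by exists (N.to_nat c); rewrite ?mem_iota ?N2Nat.id.
Qed.

Lemma testbit_codes d c i :
  c \in codes d -> (d <= i)%N -> N.testbit c (N.of_nat i) = false.
Proof.
rewrite mem_codes => lt_c le_di; case: (N.eq_dec c 0) => [->|c0].
  exact: N.bits_0.
apply: N.bits_above_log2; apply: (N.lt_le_trans _ (N.of_nat d)); last by lia.
apply/N.log2_lt_pow2; first lia.
suff -> : (2 ^ N.of_nat d = N.of_nat (2 ^ d))%num by lia.
elim: (d) => // d' IH; rewrite expnS Nat2N.inj_succ N.pow_succ_r ?IH; lia.
Qed.

Lemma codes_testbit d c :
  (forall i, (d <= i)%N -> N.testbit c (N.of_nat i) = false) -> c \in codes d.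
Proof.
move=> hc; rewrite mem_codes; case: (N.eq_dec c 0) => [->|c0].
  by rewrite expn_gt0.
rewrite ltnNge; apply/negP => le_c; have := N.bit_log2 c c0.
rewrite -[N.log2 c]N2Nat.id hc //.
have le2 : (2 ^ N.of_nat d <= c)%num.
  suff -> : (2 ^ N.of_nat d = N.of_nat (2 ^ d))%num by lia.
  elim: (d) => // d' IH; rewrite expnS Nat2N.inj_succ N.pow_succ_r ?IH; lia.
by have := N.log2_le_mono _ _ le2; rewrite N.log2_pow2; lia.
Qed.

Lemma codes_lxor d a b :
  a \in codes d -> b \in codes d -> N.lxor a b \in codes d.
Proof.
move=> ha hb; apply: codes_testbit => i le_i.
by rewrite N.lxor_spec !(testbit_codes _ le_i).
Qed.

Lemma lxorKl a b : N.lxor a (N.lxor a b) = b.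
Proof. by rewrite -N.lxor_assoc N.lxor_nilpotent N.lxor_0_l. Qed.

Lemma codes_leq d d' c : (d <= d')%N -> c \in codes d -> c \in codes d'.
Proof. by rewrite !mem_codes => le_d /leq_trans-> //; rewrite leq_exp2l. Qed.

Definition code_quads (M : seq N) (c : N) : nat :=
  \sum_(a <- M) \sum_(b <- M) (N.lxor c (N.lxor a b) \in M).

Definition sum_free (G : finZmodType) (S : {set G}) : bool :=
  [forall a in S, forall b in S, a + b \notin S].

Definition quads (G : finZmodType) (S : {set G}) (s : G) : nat :=
  \sum_(b in S) \sum_(c in S) ((s + b + c)%R \in S).

Definition energy (G : finZmodType) (S : {set G}) : nat :=
  \sum_(s in S) quads S s.

Definition words4 (G : finZmodType) (S : {set G}) : {set {set G}} :=
  [set W : {set G} | [&& W \subset S, #|W| == 4%N & \sum_(x in W) x == 0]].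

Definition lincomb (G : zmodType) (b : seq G) (c : N) : G :=
  \sum_(i < size b) (if N.testbit c (N.of_nat i) then b`_i else 0).

(** In characteristic 2 this is the union of the cosets [lincomb b c + X] for [c] in [M]; for a
    frame it is the preimage of [M] under the coordinates modulo [X]. *)
Definition blowup (G : finZmodType) (b : seq G) (X : {set G}) (M : seq N) :
  {set G} := [set g | has (fun c => g + lincomb b c \in X) M].

(* [X] is a subgroup, and [b] is a basis of a complement of [X] in the group  *)
(* generated by [b] and [X].                                                  *)
Definition frame (G : finZmodType) (b : seq G) (X : {set G}) : Prop :=
  [/\ 0 \in X, {in X &, forall x y, x + y \in X}
    & forall c, c \in codes (size b) -> lincomb b c \in X -> c = 0%num].

(** * Groups of exponent 2 and unions of cosets *)

Section Char2.
Variable G : finZmodType.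
Hypothesis addxx : forall x : G, x + x = 0.
Implicit Types (S X : {set G}) (b : seq G) (M : seq N).

Lemma oppx (x : G) : - x = x.
Proof. by apply/eqP; rewrite eq_sym -addr_eq0 addxx. Qed.

Lemma addxK (x y : G) : x + y + y = x.
Proof. by rewrite -addrA addxx addr0. Qed.

Lemma addKx (x y : G) : x + (x + y) = y.
Proof. by rewrite addrA addxx add0r. Qed.

Lemma addx_eq0 (x y : G) : (x + y == 0) = (x == y).
Proof. by rewrite -{1}[y]oppx subr_eq0. Qed.

Lemma sum_freeP S :
  reflect {in S &, forall x y, x + y \notin S} (sum_free S).
Proof.
apply: (iffP forall_inP) => [h x y xS yS|h x xS].
  by move/forall_inP: (h x xS); apply.
by apply/forall_inP => y; apply: h.
Qed.

Lemma sum_freeS S S' : S \subset S' -> sum_free S' -> sum_free S.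
Proof.
move=> /subsetP sub /sum_freeP h; apply/sum_freeP => x y /sub xS /sub yS.
by apply: contra (h _ _ xS yS); apply: sub.
Qed.

Lemma lincomb0 b : lincomb b 0 = 0.
Proof. by rewrite /lincomb big1 // => i _; rewrite N.bits_0. Qed.

Lemma lincomb_lxor b c d : lincomb b (N.lxor c d) = lincomb b c + lincomb b d.
Proof.
rewrite /lincomb -big_split; apply: eq_bigr => i _ /=; rewrite N.lxor_spec.
by do 2!case: N.testbit; rewrite /= ?addr0 ?add0r ?addxx.
Qed.

Lemma lincomb_rcons b y c :
  lincomb (rcons b y) c = lincomb b c + (if N.testbit c (N.of_nat (size b)) then y else 0).
Proof.
rewrite /lincomb size_rcons big_ord_recr /=; congr (_ + _); last first.
  by rewrite nth_rcons ltnn eqxx.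
by apply: eq_bigr => i _; rewrite nth_rcons ltn_ord.
Qed.

Section Frame.
Variables (b : seq G) (X : {set G}).
Hypothesis fr : frame b X.
Let d := size b.

Lemma frame_inj c c' : c \in codes d -> c' \in codes d ->
  lincomb b c + lincomb b c' \in X -> c = c'.
Proof.
case: fr => _ _ h hc hc'; rewrite -lincomb_lxor => /(h _ (codes_lxor hc hc')).
by move/N.lxor_eq.
Qed.

Lemma mem_blowup M c x : {subset M <= codes d} -> c \in codes d -> x \in X ->
  (lincomb b c + x \in blowup b X M) = (c \in M).
Proof.
case: (fr) => X0 XD _ sM hc xX; rewrite inE; apply/hasP/idP => [[c' c'M]|cM].
  move=> h; suff -> : c = c' by [].
  apply: frame_inj => //; first exact: sM.
  by have := XD _ _ h xX; rewrite addrAC addxK.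
by exists c; rewrite // addrAC addxx add0r.
Qed.

Lemma big_blowup (F : G -> nat) M : uniq M -> {subset M <= codes d} ->
  (\sum_(g in blowup b X M) F g =
   \sum_(c <- M) \sum_(x in X) F (lincomb b c + x)%R)%N.
Proof.
move=> uM sM.
under [RHS]eq_bigr => c _.
  rewrite (reindex_inj (addrI (lincomb b c))) /=.
  under eq_bigr do rewrite addKx.
  over.
rewrite /= (exchange_big_dep xpredT) //= big_mkcond /=; apply: eq_bigr => g _.
rewrite big_const_seq iter_addn_0 inE.
(* A point is counted at most once, since its code is unique modulo [X]. *)
have -> : count (fun c => lincomb b c + g \in X) M =
          has (fun c => g + lincomb b c \in X) M.
  elim: M uM sM => //= c M IH /andP[cM uM] sM.
  rewrite IH // => [|c' c'M]; last by apply: sM; rewrite inE c'M orbT.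
  rewrite [g + _]addrC; case: (boolP (_ + g \in X)) => //= hX.
  case: hasP => // -[c' c'M hX']; case/negP: cM.
  suff -> : c = c' by [].
  apply: frame_inj; rewrite ?sM ?inE ?eqxx ?c'M ?orbT //.
  case: fr => _ XD _; have := XD _ _ hX hX'.
  by rewrite addrA addxK.
by case: has; rewrite ?mul1n ?muln1 ?muln0.
Qed.

Lemma card_blowup M : uniq M -> {subset M <= codes d} ->
  #|blowup b X M| = (size M * #|X|)%N.
Proof.
move=> uM sM; rewrite -sum1_card big_blowup //.
under eq_bigr do rewrite sum1_card.
by rewrite big_const_seq count_predT iter_addn_0 mulnC.
Qed.

Lemma quads_blowup M c x : uniq M -> {subset M <= codes d} ->
  c \in codes d -> x \in X ->
  quads (blowup b X M) (lincomb b c + x) = (#|X| ^ 2 * code_quads M c)%N.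
Proof.
move=> uM sM hc xX; rewrite /quads big_blowup // /code_quads big_distrr /=.
apply: eq_big_seq => a aM; rewrite big_distrr /=.
transitivity (\sum_(y in X) \sum_(a' <- M)
   (#|X| * (N.lxor c (N.lxor a a') \in M)))%N; last first.
  by rewrite sum_nat_const big_distrr /=; apply: eq_bigr => a' _; rewrite mulnA.
apply: eq_bigr => y yX; rewrite big_blowup //; apply: eq_big_seq => a' a'M.
rewrite -sum_nat_const; apply: eq_bigr => z zX.
have -> : lincomb b c + x + (lincomb b a + y) + (lincomb b a' + z) =
          lincomb b (N.lxor c (N.lxor a a')) + (x + y + z).
  rewrite !lincomb_lxor.
  by rewrite (addrACA (lincomb b c)) (addrACA (_ + lincomb b a)) !addrA.
have hk : N.lxor c (N.lxor a a') \in codes d.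
  by apply: codes_lxor => //; apply: codes_lxor; apply: sM.
by case: (fr) => _ XD _; rewrite mem_blowup ?XD.
Qed.

Lemma energy_blowup M : uniq M -> {subset M <= codes d} ->
  energy (blowup b X M) = (#|X| ^ 3 * \sum_(c <- M) code_quads M c)%N.
Proof.
move=> uM sM; rewrite /energy big_blowup // big_distrr /=.
apply: eq_big_seq => c cM; rewrite expnS -mulnA -sum_nat_const.
by apply: eq_bigr => x xX; rewrite quads_blowup ?sM.
Qed.

Lemma sum_free_blowup M : {subset M <= codes d} ->
  all (fun a => all (fun a' => N.lxor a a' \notin M) M) M ->
  sum_free (blowup b X M).
Proof.
move=> sM /allP sfM; apply/sum_freeP => g g'; rewrite 2!inE.
move=> /hasP[c cM hg] /hasP[c' c'M hg'].
have -> : g + g' = lincomb b (N.lxor c c') + (g + lincomb b c + (g' + lincomb b c')).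
  rewrite lincomb_lxor (addrC g (lincomb _ _)) (addrC g' (lincomb _ _)).
  by rewrite [RHS]addrACA !addKx.
have hx : g + lincomb b c + (g' + lincomb b c') \in X by case: fr => _ XD _; apply: XD.
have hk : N.lxor c c' \in codes d by apply: codes_lxor; apply: sM.
by rewrite mem_blowup //; move/allP: (sfM _ cM); apply.
Qed.

Lemma frame_card : (2 ^ d * #|X| <= #|G|)%N.
Proof.
have := max_card (blowup b X (codes d)).
by rewrite card_blowup ?codes_uniq // size_map size_iota.
Qed.

Lemma frame_span : (#|G| <= 2 ^ d * #|X|)%N ->
  forall g, exists2 c, c \in codes d & g + lincomb b c \in X.
Proof.
move=> le_G g; have : g \in blowup b X (codes d).
  suff /eqP -> : blowup b X (codes d) == setT by rewrite inE.
  rewrite -subTset; apply/setIidPl/eqP; rewrite setTI eqEcard subsetT /=.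
  by rewrite cardsT card_blowup ?codes_uniq // size_map size_iota.
by rewrite inE => /hasP[c]; exists c.
Qed.

Lemma frame_rcons y : (forall c, c \in codes d -> y + lincomb b c \notin X) ->
  frame (rcons b y) X.
Proof.
case: (fr) => X0 XD h hy; split=> // c; rewrite size_rcons -/d => hc.
(* Clearing the top bit leaves the part of the combination on [b]. If that bit was set, membership
   in [X] contradicts the choice of [y]; otherwise the old frame applies. *)
rewrite lincomb_rcons -/d; pose c' := N.clearbit c (N.of_nat d).
have c'E i : N.testbit c' (N.of_nat i) = (N.testbit c (N.of_nat i)) && (d != i).
  rewrite /c' N.clearbit_eqb; case: N.testbit => //=.
  by case: N.eqb_spec; case: eqP; lia.
have hc' : c' \in codes d.
  apply: codes_testbit => i le_i; rewrite c'E.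
  case: (ltngtP d i) le_i => // [lt_i _|_ _]; last by rewrite andbF.
  by rewrite (testbit_codes hc).
have sc' : lincomb b c' = lincomb b c.
  apply: eq_bigr => i _; rewrite c'E; case: eqP => [di|]; rewrite ?andbT //.
  by have := ltn_ord i; rewrite -di ltnn.
case hb: N.testbit.
  by rewrite -sc' addrC => hX; move: (hy _ hc'); rewrite hX.
rewrite addr0 -sc' => /(h _ hc') c'0; apply: N.bits_inj => j.
rewrite N.bits_0.
have := c'E (N.to_nat j); rewrite c'0 N.bits_0 N2Nat.id.
case: eqP => [dj _|_]; last by rewrite andbT => <-.
by move: hb; rewrite dj N2Nat.id.
Qed.

End Frame.
End Char2.

(** * Words of length 4 and additive energy *)

Section Char2.
Variable G : finZmodType.
Hypothesis addxx : forall x : G, x + x = 0.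
Implicit Types (S X : {set G}).

(** The fourth point of a word is the sum of the other three, and [s + b + c] differs from [s], [b]
    and [c] because these are distinct. *)
Lemma card_words4_of3 S (s b c : G) : s \in S -> b \in S -> c \in S ->
  b != s -> c != s -> c != b ->
  #|[set W in words4 S | [&& s \in W, b \in W & c \in W]]| = (s + b + c \in S).
Proof.
move=> sS bS cS bs cs cb; have [d dE] : {d | s + b + c = d} by exists (s + b + c).
have sumd : s + b + c + d = 0 by rewrite dE addxx.
have ds : d != s.
  by rewrite -(addx_eq0 addxx) -dE addrAC (addrAC s) addxx add0r (addx_eq0 addxx) eq_sym.
have db : d != b.
  by rewrite -(addx_eq0 addxx) -dE addrAC (addxK addxx) (addx_eq0 addxx) eq_sym.
have dc : d != c.
  by rewrite -(addx_eq0 addxx) -dE (addxK addxx) (addx_eq0 addxx) eq_sym.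
have eqW W : W \in words4 S -> s \in W -> b \in W -> c \in W ->
    W = [set s; b; c; d].
  rewrite inE => /and3P[_ /eqP cW /eqP sW] sIn bIn cIn.
  have /cards1P[d' W'] : #|W :\ s :\ b :\ c| == 1%N.
    have := cardsD1 s W; have := cardsD1 b (W :\ s).
    have := cardsD1 c (W :\ s :\ b).
    rewrite !inE sIn bIn cIn bs cs cb cW /= => e1 e2.
    by rewrite e2 e1 !add1n => -[<-].
  have eW : W = s |: (b |: (c |: [set d'])).
    by rewrite -W' !setD1K // !inE ?cs ?cb ?bs ?cIn ?bIn.
  have /and3P[d'c d'b d's] : [&& d' != c, d' != b & d' != s].
    have : d' \in W :\ s :\ b :\ c by rewrite W' set11.
    by rewrite !inE => /and4P[-> -> -> _].
  move: sW; rewrite eW !big_setU1 ?inE ?big_set1 /=.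
  - rewrite !addrA => /eqP; rewrite (addx_eq0 addxx) => /eqP e.
    by rewrite -dE e; apply/setP => z; rewrite !inE !orbA.
  - by rewrite eq_sym.
  - by rewrite negb_or eq_sym cb eq_sym.
  - by rewrite !negb_or eq_sym bs eq_sym cs eq_sym.
rewrite dE; have [dS|dS] := boolP (d \in S); last first.
  apply: eq_card0 => W; rewrite !inE; apply/negP => /andP[hW].
  case/and3P=> sW bW cW.
  have hW' : W \in words4 S by rewrite inE.
  case/and3P: hW => /subsetP sub _ _; case/negP: dS; apply: sub.
  by rewrite (eqW W) // !inE eqxx !orbT.
apply/eqP/cards1P; exists [set s; b; c; d]; apply/setP => W; rewrite in_set1.
apply/idP/eqP => [|->]; first by rewrite !inE => /andP[h /and3P[]]; apply: eqW; rewrite inE.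
rewrite !inE !eqxx ?orbT /= andbT; apply/and3P; split.
- by apply/subsetP => z; rewrite !inE => /orP[/orP[/orP[]|]|] /eqP->.
- rewrite -!setUA !cardsU1 cards1 !inE !negb_or.
  rewrite (eq_sym s) bs (eq_sym s) cs (eq_sym s) ds.
  by rewrite (eq_sym b) cb (eq_sym b) db (eq_sym c) dc.
- rewrite -!setUA !big_setU1 ?big_set1 ?inE ?negb_or /=.
  + by rewrite !addrA sumd.
  + by rewrite eq_sym.
  + by rewrite eq_sym cb eq_sym.
  + by rewrite eq_sym bs eq_sym cs eq_sym.
Qed.

(** The pairs with [b = s], [c = s] or [b = c] always count, 3 |S| - 2 in all because the three
    families share only the pair (s, s). Every other pair orders two of the three remaining points
    of a word through [s], giving 6 pairs per word. *)
Lemma quads_words4 S (s : G) : s \in S ->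
  (quads S s + 2 = 6 * #|[set W in words4 S | s \in W]| + 3 * #|S|)%N.
Proof.
move=> sS; rewrite /quads (bigD1 s) //=.
under eq_bigr => c cS do rewrite addxx add0r cS.
rewrite sum1_card.
set D := [set W in words4 S | s \in W].
under eq_bigr => b /andP[bS bs].
  rewrite (bigD1 s) //= (bigD1 b) ?bS //= addrAC addxx add0r bS (addxK addxx) sS.
  under eq_bigr => c /andP[/andP[cS cs] cb].
    rewrite -card_words4_of3 // -sum1_card.
    rewrite (eq_bigl (fun W => (W \in D) && ((b \in W) && (c \in W)))); last first.
      by move=> W; rewrite !inE; case: (s \in W); rewrite ?andbT ?andbF.
    rewrite big_mkcondr.
    over.
  rewrite exchange_big /=.
  over.
rewrite /= !big_split /= exchange_big /=.
have cS1 : #|S| = (#|S :\ s|).+1 by rewrite (cardsD1 s) sS.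
have sum1 : (\sum_(i in S | i != s) 1 = #|S :\ s|)%N.
  by rewrite sum1_card; apply: eq_card => i; rewrite !inE andbC.
rewrite sum1.
set T := (\sum_(W in D) _)%N; suff -> : T = (6 * #|D|)%N.
  by rewrite cS1; move: #|D| #|S :\ s| => x y; lia.
rewrite /T mulnC -sum_nat_const; apply: eq_bigr => W; rewrite !inE.

case/andP=> /and3P[/subsetP WS /eqP cW _] sW.
transitivity (\sum_(b in W :\ s) \sum_(c in W :\ s :\ b) 1)%N.
  rewrite [RHS]big_mkcond [LHS]big_mkcond /=; apply: eq_bigr => b _.
  rewrite !inE; case: (boolP (b \in W)) => bW; rewrite ?andbF ?andbT.
    rewrite (WS _ bW); case: (b != s) => //=.
    rewrite big_mkcond [RHS]big_mkcond; apply: eq_bigr => c _; rewrite !inE.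
    case: (boolP (c \in W)) => cW'; rewrite ?andbF ?if_same //.
    by rewrite (WS _ cW') /= andbT andbC.
  by case: ifP => // _; rewrite big1.
under eq_bigr => b bW.
  have cb := cardsD1 b (W :\ s); rewrite bW in cb.
  have cs := cardsD1 s W; rewrite sW cW in cs.
  rewrite sum1_card (_ : #|_| = 2%N); last by lia.
  over.
rewrite sum_nat_const; have cs := cardsD1 s W; rewrite sW cW in cs; lia.
Qed.

Lemma sum_words4 S : (\sum_(s in S) #|[set W in words4 S | s \in W]| = 4 * #|words4 S|)%N.
Proof.
under eq_bigr do rewrite -sum1_card big_mkcond.
rewrite exchange_big /= -[in RHS]sum1_card big_distrr /= [RHS]big_mkcond /=.
apply: eq_bigr => W _; case: ifP => WW; last first.
  by rewrite big1 // => s _; rewrite inE WW.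
under eq_bigr do rewrite inE WW /=.
rewrite muln1 -big_mkcondr /= sum1_card.
move: WW; rewrite inE => /and3P[/subsetP WS /eqP cW _]; rewrite -[RHS]cW.
by apply: eq_card => s; rewrite unfold_in; apply/andP/idP => [[]|sW] //; rewrite WS.
Qed.

Lemma energy_words4 S :
  (energy S + 2 * #|S| = 24 * #|words4 S| + 3 * #|S| ^ 2)%N.
Proof.
have := sum_words4 S.
have : (\sum_(s in S) (quads S s + 2) =
        \sum_(s in S) (6 * #|[set W in words4 S | s \in W]| + 3 * #|S|))%N.
  by apply: eq_bigr => s; apply: quads_words4.
have -> : (\sum_(s in S) (6 * #|[set W in words4 S | s \in W]| + 3 * #|S|) =
    6 * (\sum_(s in S) #|[set W in words4 S | s \in W]|) + 3 * #|S| ^ 2)%N.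
  by rewrite big_split sum_nat_const big_distrr; congr addn; rewrite -mulnn; ring.
rewrite big_split /= !sum_nat_const -/(energy S) => h h'; rewrite h' in h.
by rewrite mulnC h mulnA.
Qed.

Lemma words4_setD1 S (s : G) :
  (#|words4 S| = #|words4 (S :\ s)| + #|[set W in words4 S | s \in W]|)%N.
Proof.
rewrite -(cardsID [set W : {set G} | s \in W]) addnC; congr (_ + _)%N.
  apply: eq_card => W; rewrite !inE subsetD1.
  by case: (s \in W); rewrite ?andbF ?andbT.
by apply: eq_card => W; rewrite !inE.
Qed.

(** A word not inside [S'] passes through some point of [S] outside [S']. *)
Lemma words4_sub_lb S S' D : S' \subset S ->
  (forall s, s \in S -> #|[set W in words4 S | s \in W]| <= D)%N ->
  (#|words4 S| <= #|words4 S'| + (#|S| - #|S'|) * D)%N.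
Proof.
move=> sub hD; rewrite -(cardsID (words4 S') (words4 S)); apply: leq_add.
  by apply: subset_leq_card; apply: subsetIr.
have <- : #|S :\: S'| = (#|S| - #|S'|)%N by rewrite cardsD (setIidPr sub).
apply: (@leq_trans (\sum_(s in S :\: S') #|[set W in words4 S | s \in W]|)); last first.
  rewrite -sum_nat_const; apply: leq_sum => s; rewrite inE => /andP[_].
  exact: hD.
under eq_bigr do rewrite -sum1_card big_mkcond.
rewrite exchange_big /= -sum1_card big_mkcond /=; apply: leq_sum => W _.
case: ifP => //; rewrite !inE => /andP[nW /and3P[WS cW sW]].
have /subsetPn[s sW' nS'] : ~~ (W \subset S') by move: nW; rewrite cW sW !andbT.
rewrite (bigD1 s) /=; last by rewrite !inE nS' (subsetP WS).
by rewrite !inE WS cW sW sW'.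
Qed.

(** Each word has four points, so on average a point lies on a fraction 4 / |S| of the words; some
    point reaches the average. *)
Lemma words4_remove S : S != set0 -> exists2 s, s \in S &
  (#|S| * #|words4 (S :\ s)| + 4 * #|words4 S| <= #|S| * #|words4 S|)%N.
Proof.
move=> S0; suff [s sS h] : exists2 s, s \in S &
    (4 * #|words4 S| <= #|S| * #|[set W in words4 S | s \in W]|)%N.
  by exists s => //; rewrite [in leqRHS](words4_setD1 S s) mulnDr leq_add2l.
apply/exists_inP; apply: contraT => /exists_inPn h.
have {}h s : s \in S ->
    (#|S| * #|[set W in words4 S | s \in W]| < 4 * #|words4 S|)%N.
  by move/h; rewrite ltnNge.
case/set0Pn: S0 => s0 s0S; move: (sum_words4 S).
have : (\sum_(s in S) (#|S| * #|[set W in words4 S | s \in W]|).+1 <=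
        \sum_(s in S) 4 * #|words4 S|)%N by apply: leq_sum.
have -> : (\sum_(s in S) (#|S| * #|[set W in words4 S | s \in W]|).+1 =
    #|S| * (\sum_(s in S) #|[set W in words4 S | s \in W]|) + #|S|)%N.
  under eq_bigr do rewrite -addn1.
  by rewrite big_split sum1_card big_distrr.
rewrite sum_nat_const => h1 h2; rewrite h2 in h1.
have : (0 < #|S|)%N by rewrite card_gt0; apply/set0Pn; exists s0.
nia.
Qed.

(* Deleting a point lying in the largest number of words, one at a time,      *)
(* multiplies the number of words by at most 1 - 4 / m <= ((m - 1) / m) ^ 4.  *)
Lemma words4_subset S n : (n <= #|S|)%N -> exists2 S' : {set G},
  (S' \subset S) && (#|S'| == n) &
  (#|words4 S'| * #|S| ^ 4 <= #|words4 S| * n ^ 4)%N.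
Proof.
move: {2}(#|S| - n)%N (erefl (#|S| - n)%N) => m; elim: m n => [|m IH] n em le_n.
  exists S; first by rewrite subxx; lia.
  by rewrite (_ : n = #|S|) //; lia.
have [||S' /andP[sub /eqP cS'] hS'] := IH n.+1; [lia|lia|].
have S'0 : S' != set0 by rewrite -card_gt0 cS'.
have [s sS' hs] := words4_remove S'0.
exists (S' :\ s).
  rewrite (subset_trans (subsetDl _ _) sub) /=.
  by have := cardsD1 s S'; rewrite sS' cS' add1n => -[<-].
rewrite cS' in hs; move: hs hS'.
set a := #|words4 (S' :\ s)|; set a' := #|words4 S'|; set p := #|words4 S|.
set q := (#|S| ^ 4)%N; move=> hs hS'.
have h1 : (a * n.+1 ^ 4 <= a' * n ^ 4)%N.
  have : (a * n.+1 ^ 4 + 4 * a' * n.+1 ^ 3 <= a' * n.+1 ^ 4)%N by nia.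
  have : (n.+1 ^ 4 <= n ^ 4 + 4 * n.+1 ^ 3)%N by nia.
  nia.
have : (a * q * n.+1 ^ 4 <= p * n ^ 4 * n.+1 ^ 4)%N by nia.
by rewrite leq_pmul2r ?expn_gt0.
Qed.

Definition reps S (x : G) : nat := \sum_(a in S) ((x + a)%R \in S).

Lemma sum_reps S (F : G -> nat) :
  (\sum_(a in S) \sum_(b in S) F (a + b)%R = \sum_x F x * reps S x)%N.
Proof.
transitivity (\sum_(a in S) \sum_(x | (x + a)%R \in S) F x)%N.
  apply: eq_bigr => a aS; rewrite [RHS](reindex_inj (addIr a)) /=.
  by apply: eq_big => [x|x _]; rewrite ?(addxK addxx) // addrC.
rewrite (exchange_big_dep xpredT) //=; apply: eq_bigr => x _.
rewrite sum_nat_const mulnC /reps; congr (_ * _)%N; rewrite -sum1_card.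
by rewrite big_mkcondr /=; apply: eq_bigr => a _; case: (_ \in _).
Qed.

Lemma energy_reps S : energy S = (\sum_x reps S x ^ 2)%N.
Proof.
rewrite /energy /quads -/(reps S) (sum_reps S (reps S)).
by apply: eq_bigr => x _; rewrite mulnn.
Qed.

Lemma leq_sqr_sum_card (I : finType) (A : {set I}) (F : I -> nat) :
  ((\sum_(i in A) F i) ^ 2 <= #|A| * \sum_(i in A) F i ^ 2)%N.
Proof.
rewrite -(@leq_pmul2l 2) // expnS expn1.
have -> : (2 * (#|A| * \sum_(i in A) F i ^ 2) =
  \sum_(i in A) \sum_(j in A) (F i ^ 2 + F j ^ 2))%N.
  under [RHS]eq_bigr do rewrite big_split /= sum_nat_const.
  by rewrite big_split /= -big_distrr /= sum_nat_const; lia.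
rewrite big_distrl /= big_distrr /=; apply: leq_sum => i _.
rewrite big_distrr big_distrr /=; apply: leq_sum => j _.
exact: nat_Cauchy.
Qed.

Lemma energy_no_pentagon S : sum_free S ->
  (forall a b c d e, a \in S -> b \in S -> c \in S -> d \in S -> e \in S ->
    a + b + c + d + e != 0) ->
  (2 * #|S| ^ 4 <= #|G| * energy S)%N.
Proof.
move=> sfS h5; have [->|/set0Pn[s sS]] := eqVneq S set0; first by rewrite cards0.
(* [A] is the sumset S + S, the support of [reps S]; a point common to [A] and [s + A] would give
   five elements of [S] with sum 0. *)
pose A : {set G} := [set x | reps S x != 0%N].
have repsP x : x \in A -> exists2 a, a \in S & x + a \in S.
  rewrite inE => h; apply/exists_inP; apply: contraT => /exists_inPn h'.
  case/eqP: h; rewrite /reps big1 // => a aS.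
  by rewrite (negbTE (h' a aS)).
have leA : (2 * #|A| <= #|G|)%N.
  rewrite mul2n -addnn -{2}(card_imset (mem A) (addrI s)).
  rewrite -cardsUI (_ : A :&: _ = set0) ?cards0 ?addn0 ?max_card //.
  apply/setP => x; rewrite !inE; apply/negP => /andP[xA /imsetP[y yA xE]].
  have [a aS xaS] : exists2 a, a \in S & x + a \in S by apply: repsP; rewrite inE.
  have [b bS ybS] := repsP _ yA.
  have /negP[] := h5 _ _ _ _ _ xaS aS ybS bS sS.
  by rewrite (addxK addxx) addrA (addxK addxx) xE (addxK addxx) addxx.
have -> : energy S = (\sum_(x in A) reps S x ^ 2)%N.
  rewrite energy_reps [RHS]big_mkcond /=; apply: eq_bigr => x _.
  by rewrite inE; case: (reps S x).
have sumA : (\sum_(x in A) reps S x = #|S| ^ 2)%N.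
  have := sum_reps S (fun => 1%N); rewrite !sum_nat_const muln1 mulnn => ->.
  rewrite [LHS]big_mkcond /=; apply: eq_bigr => x _.
  by rewrite inE; case: (reps S x) => // m; rewrite mul1n.
have := leq_sqr_sum_card A (reps S); rewrite sumA => h.
apply: (@leq_trans (2 * (#|A| * \sum_(x in A) reps S x ^ 2))); last first.
  by rewrite mulnA leq_mul2r leA orbT.
by rewrite leq_mul2l /=; apply: leq_trans h; rewrite -expnM.
Qed.

End Char2.

(** * Independent sets in the Clebsch graph *)

Fixpoint combs (T : Type) (l : seq T) (k : nat) : seq (seq T) :=
  match l, k with
  | _, 0 => [:: [::]]
  | [::], _.+1 => [::]
  | x :: l', k'.+1 => map (cons x) (combs l' k') ++ combs l' k
  end.

Lemma mem_combs (T : eqType) (s l : seq T) :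
  subseq s l -> s \in combs l (size s).
Proof.
elim: l s => [|y l IH] [|x s] //=; rewrite mem_cat.
case: eqP => [->|_] sub; last by rewrite (IH (x :: s)) ?orbT.
by rewrite map_f //; apply: IH.
Qed.

(* The codes of e_1, ..., e_4 and e_1 + e_2 + e_3 + e_4.                      *)
Definition pent : seq N := [:: 1; 2; 4; 8; 15]%num.

(** Independence in the Cayley graph of F_2^4 with connection set [pent], which is the Clebsch
    graph. *)
Definition indep (s : seq N) : bool :=
  all (fun a => all (fun a' => N.lxor a a' \notin pent) s) s.

Lemma sub_indep s s' : {subset s <= s'} -> indep s' -> indep s.
Proof.
move=> sub /allP h; apply/allP => a /sub/h/allP h'.
by apply/allP => a' /sub/h'.
Qed.

Lemma pent_codes : {subset pent <= codes 4}.
Proof. exact/allP. Qed.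

Lemma pent_uniq : uniq pent. Proof. by []. Qed.

(** The extremal independent sets are vertex neighbourhoods; in [size_slice] the vertex [v] provides
    an element of [shifts]. *)
Lemma indep_size5 : all (fun s => indep s ==>
  has (fun v => all (fun e => N.lxor v e \in s) pent) (codes 4))
  (combs (codes 4) 5).
Proof. by vm_compute. Qed.

Lemma indep_size6 : all (fun s => ~~ indep s) (combs (codes 4) 6).
Proof. by vm_compute. Qed.

Lemma leq_size_indep (P : pred N) : indep (filter P (codes 4)) ->
  (size (filter P (codes 4)) <= 5)%N.
Proof.
set s := filter _ _ => ind; rewrite leqNgt; apply/negP => lt5.
have sz6 : size (take 6 s) = 6%N by rewrite size_takel.
have : take 6 s \in combs (codes 4) 6.
  have := mem_combs (subseq_trans (take_subseq s 6) (filter_subseq P (codes 4))).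
  by rewrite sz6.
move/(allP indep_size6)/negP; apply; apply: sub_indep ind => c.
exact: mem_take.
Qed.

(** Read [d] as the difference of two vertices. If they are distinct and not adjacent, they have a
    common neighbour, and some neighbour of one is adjacent to some neighbour of the other. *)
Lemma code_dist2 : all (fun d => [|| d == 0%num, d \in pent |
    has (fun e => N.lxor d e \in pent) pent &&
    has (fun e => has (fun e' => N.lxor d (N.lxor e e') \in pent) pent) pent])
  (codes 4).
Proof. by vm_compute. Qed.

Section Weight.
Variable U : 'I_4 -> pred N.
Hypothesis indU : forall i, indep (filter (U i) (codes 4)).
Let n c := (\sum_i U i c)%N.

Lemma indepU i c e : c \in codes 4 -> e \in pent ->
  U i c -> U i (N.lxor c e) = false.
Proof.
move=> hc he Uc; apply/negbTE/negP => Ue.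
have he' := codes_lxor hc (pent_codes he).
have /allP/(_ c) := indU i; rewrite mem_filter Uc hc => /(_ isT).
move=> /allP/(_ (N.lxor c e)); rewrite mem_filter Ue he' => /(_ isT).
by rewrite lxorKl he.
Qed.

Lemma sum_nat_pred (T : eqType) (P : pred T) (s : seq T) :
  (\sum_(c <- s) P c = count P s)%N.
Proof.
by rewrite -sum1_count [RHS]big_mkcond; apply: eq_bigr => c _; case: (P c).
Qed.

Lemma sum_cover : (\sum_(c <- codes 4) n c <= 20)%N.
Proof.
rewrite exchange_big /=; apply: (@leq_trans (\sum_(i < 4) 5)); last first.
  by rewrite sum_nat_const card_ord.
by apply: leq_sum => i _; rewrite sum_nat_pred -size_filter leq_size_indep.
Qed.

Lemma n_eq0 c : (n c == 0%N) = [forall i, ~~ U i c].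
Proof.
rewrite /n sum_nat_eq0; apply/forall_inP/forallP => [h i|h i _].
  by have := h i isT; case: (U i c).
by rewrite (negbTE (h i)).
Qed.

Lemma cover_size (P : pred N) (l : seq N) : uniq l ->
  (forall c, c \in l -> (c \in codes 4) && P c) -> (size l <= count P (codes 4))%N.
Proof.
move=> ul hl; rewrite -size_filter uniq_leq_size // => c /hl.
by rewrite mem_filter andbC.
Qed.

Lemma nbrs_uniq c : uniq [seq N.lxor c e | e <- pent].
Proof.
rewrite map_inj_uniq ?pent_uniq // => e e' h.
by rewrite -(lxorKl c e) h lxorKl.
Qed.

(** All four sets contain [c], so none contains a neighbour of [c]. *)
Lemma cover4 c : c \in codes 4 -> n c = 4%N ->
  (5 <= count (fun c => n c == 0%N) (codes 4))%N.
Proof.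
move=> hc nc.
have hU i : U i c.
  apply: contraT => h; have : (n c <= \sum_(j | j != i) 1)%N.
    rewrite /n (bigD1 i) //= (negbTE h) add0n; apply: leq_sum => j _.
    by case: (U j c).
  by rewrite nc sum1_card cardC1 card_ord.
rewrite -[5%N]/(size pent) -(size_map (N.lxor c)); apply: cover_size.
  exact: nbrs_uniq.
move=> _ /mapP[e he ->]; rewrite codes_lxor ?(pent_codes he) //= n_eq0.
by apply/forallP => i; rewrite indepU.
Qed.

Lemma cover3_miss c : n c = 3%N -> exists j, forall i, U i c = (i != j).
Proof.
move=> nc; have [j hj] : exists j, ~~ U j c.
  apply/existsP; apply: contraT; rewrite negb_exists => /forallP h.
  have : n c = (\sum_(i < 4) 1)%N.
    by apply: eq_bigr => i _; have := h i; rewrite negbK => ->.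
  by rewrite nc sum1_card card_ord.
exists j => i; have [->|ij] := eqVneq i j; first exact: negbTE.
apply: contraT => hi; have : (n c <= \sum_(k | (k != j) && (k != i)) 1)%N.
  rewrite /n (bigD1 j) //= (negbTE hj) add0n (bigD1 i) //= (negbTE hi) add0n.
  by apply: leq_sum => k _; case: (U k c).
have := cardD1 i (predC1 j); rewrite cardC1 card_ord !inE ij /= nc sum1_card => e.
rewrite (_ : #|_| = #|[predD1 predC1 j & i]|); last first.
  by apply: eq_card => k; rewrite !inE andbC.
by move: e; rewrite add1n => -[<-]; rewrite ltnn.
Qed.

(* If nothing is uncovered, then all neighbours of a point covered three      *)
(* times are covered by the remaining set; two such points would share this   *)
(* set, as they have a common neighbour, but their neighbourhoods together    *)
(* are not independent.                                                       *)
Lemma cover3_uniq : (forall c, c \in codes 4 -> n c != 0%N) ->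
  {in codes 4 &, forall c c', n c = 3%N -> n c' = 3%N -> c = c'}.
Proof.
move=> n0 c c' hc hc' /cover3_miss[j hj] /cover3_miss[j' hj'].
have nbr d k e : d \in codes 4 -> (forall i, U i d = (i != k)) ->
    e \in pent -> forall i, U i (N.lxor d e) = (i == k).
  move=> hd hk he; have hde := codes_lxor hd (pent_codes he).
  have U0 i : i != k -> U i (N.lxor d e) = false by rewrite -hk; apply: indepU.
  move=> i; have [->|/U0//] := eqVneq i k.
  move: (n0 _ hde); rewrite n_eq0 negb_forall => /existsP[i'].
  by rewrite negbK; have [->|/U0->] := eqVneq i' k.
have [i Uc Uc'] : exists2 i, U i c & U i c'.
  have : (0 < #|[set~ j] :&: [set~ j']|)%N.
    rewrite -setCU cardsCs setCK card_ord subn_gt0.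
    by rewrite cards2; case: eqP.
  case/card_gt0P => i; rewrite !inE => /andP[ij ij'].
  by exists i; rewrite ?hj ?hj'.
have hd := codes_lxor hc hc'.
case/or3P: (allP code_dist2 _ hd).
- by move/eqP/N.lxor_eq.
- move=> dp; have := indepU hc dp Uc.
  by rewrite lxorKl Uc'.
case/andP=> /hasP[e he hde] /hasP[e1 he1 /hasP[e2 he2 h12]].
have jj' : j = j'.
  have := nbr _ _ _ hc hj he j; rewrite eqxx.
  have -> : N.lxor c e = N.lxor c' (N.lxor (N.lxor c c') e).
    by rewrite -N.lxor_assoc (N.lxor_comm c c') lxorKl.
  by rewrite (nbr _ _ _ hc' hj' hde) => /eqP.
have := nbr _ _ _ hc hj he1 j; rewrite eqxx.
have -> : N.lxor c e1 = N.lxor (N.lxor c' e2) (N.lxor (N.lxor c c') (N.lxor e1 e2)).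
  apply: N.bits_inj => i'; rewrite !N.lxor_spec.
  by do 4!case: N.testbit.
have := nbr _ _ _ hc' hj' he2 j; rewrite -jj' eqxx => U2.
by rewrite (indepU _ h12 U2) // codes_lxor ?(pent_codes he2).
Qed.

(** Bounds the number of points of [S] over one [c] in [shift_notin_sum3]: up to one for each
    covering set, or two from a single covering set. *)
Definition weight (m : nat) : nat := if m is 0 then 0 else maxn m 2.

Lemma leq_n4 c : (n c <= 4)%N.
Proof.
rewrite -[4%N]card_ord -sum1_card; apply: leq_sum => i _; by case: (U i c).
Qed.

(** With A m vertices covered m times, the sum is 32 - 2 A0 + A3 + 2 A4, and the total coverage of
    at most 20 gives 2 A3 + 3 A4 <= 4 + A0. The dangerous cases are cut off because A4 > 0 forces A0
    >= 5 and A0 = 0 forces A3 <= 1. *)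
Lemma sum_weight : (\sum_(c <- codes 4) weight (n c) <= 33)%N.
Proof.
pose A m := count (fun c => n c == m) (codes 4).
have AE m : A m = (\sum_(c <- codes 4) (n c == m))%N.
  by rewrite sum_nat_pred.
have sz : (\sum_(c <- codes 4) 1 = 16)%N by rewrite big_const_seq.
have hw : (\sum_(c <- codes 4) weight (n c) + 2 * A 0%N = 32 + A 3%N + 2 * A 4%N)%N.
  rewrite !AE -[32%N]/(2 * 16)%N -sz !big_distrr /= -!big_split /=.
  apply: eq_bigr => c _; have := leq_n4 c.
  by case: (n c) => [|[|[|[|[|m]]]]].
have hn : (16 + 2 * A 3%N + 3 * A 4%N <= 20 + A 0%N)%N.
  apply: leq_trans (leq_add sum_cover (leqnn _)).
  rewrite !AE -sz !big_distrr /= -!big_split /=.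
  apply: leq_sum => c _; have := leq_n4 c.
  by case: (n c) => [|[|[|[|[|m]]]]].
have h4 : A 4%N = 0%N \/ (5 <= A 0%N)%N.
  case: (posnP (A 4%N)) => [|h]; [by left | right].
  move: h; rewrite -has_count => /hasP[c hc /eqP nc]; exact: cover4 nc.
have h3 : (0 < A 0%N)%N \/ (A 3%N <= 1)%N.
  case: (posnP (A 0%N)) => [h|]; [right | by left].
  have n0 c : c \in codes 4 -> n c != 0%N.
    move=> hc; apply/negP => nc; move: h; apply/eqP; rewrite -lt0n -has_count.
    by apply/hasP; exists c.
  rewrite leqNgt; apply/negP; rewrite /A -size_filter.
  have := filter_uniq (fun c => n c == 3%N) (codes_uniq 4).
  case E: (filter _ _) => [|c [|c' l]] //= /andP[cl _] _.
  have hc : c \in filter (fun c => n c == 3%N) (codes 4) by rewrite E inE eqxx.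
  have hc' : c' \in filter (fun c => n c == 3%N) (codes 4) by rewrite E !inE eqxx orbT.
  move: hc hc'; rewrite !mem_filter => /andP[/eqP nc hc] /andP[/eqP nc' hc'].
  by move: cl; rewrite (cover3_uniq n0 hc hc' nc nc') inE eqxx.
lia.
Qed.

End Weight.

(** * The stabiliser of a maximal sum-free set *)

Lemma code_pent_sum : all (fun c => (c \in pent) ||
  has (fun e => has (fun e' => c == N.lxor e e') pent) pent) (codes 4).
Proof. by vm_compute. Qed.

(** Such a [c + e] is a sum of two pentagon elements, hence outside a sum-free [S]; this keeps
    nonzero elements of V out of [shifts]. *)
Lemma code_pent_shift : all (fun c => (c == 0%num) ||
  has (fun e => has (fun e1 => has (fun e2 => N.lxor c e == N.lxor e1 e2) pent)
     pent) pent) (codes 4).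
Proof. by vm_compute. Qed.

Section Pentagon.
Variable G : finZmodType.
Hypothesis addxx : forall x : G, x + x = 0.
Implicit Types (S X : {set G}) (b : seq G) (M : seq N).

Lemma sum_free_pentagon S (a b c d e : G) : a + b + c + d + e = 0 ->
  a \in S -> b \in S -> c \in S -> d \in S -> e \in S ->
  {in pent, forall i, lincomb [:: a; b; c; d] i \in S}.
Proof.
move=> /eqP; rewrite (addx_eq0 addxx) => /eqP sum aS bS cS dS eS i.
rewrite !inE => /or4P[||| /orP[]] /eqP->;
  by rewrite /lincomb !big_ord_recl big_ord0 /= ?addr0 ?add0r // !addrA sum.
Qed.

Variable S : {set G}.
Hypothesis sfS : sum_free S.
Variable b : seq G.
Hypothesis sz_b : size b = 4%N.
Hypothesis pentS : {in pent, forall e, lincomb b e \in S}.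

Definition shifts : {set G} := [set g | all (fun e => g + lincomb b e \in S) pent].

Lemma shiftsP g : reflect {in pent, forall e, g + lincomb b e \in S} (g \in shifts).
Proof. by rewrite inE; apply: allP. Qed.

Lemma shifts0 : 0 \in shifts.
Proof. by apply/shiftsP => e he; rewrite add0r pentS. Qed.

Lemma lincomb_notin c : c \in codes 4 -> c \notin pent -> lincomb b c \notin S.
Proof.
move=> /(allP code_pent_sum)/orP[->//|] /hasP[e he /hasP[e' he' /eqP->]] _.
rewrite lincomb_lxor //.
by move/(sum_freeP _): sfS; apply; apply: pentS.
Qed.

(** Two points of a slice differing by a pentagon element would be two elements of [S] with sum in
    [S]. *)
Lemma indep_slice u : indep [seq c <- codes 4 | u + lincomb b c \in S].
Proof.
apply/allP => c; rewrite mem_filter => /andP[cS hc].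
apply/allP => c'; rewrite mem_filter => /andP[c'S hc'].
apply/negP => /pentS; apply/negP.
have -> : lincomb b (N.lxor c c') = (u + lincomb b c) + (u + lincomb b c').
  by rewrite lincomb_lxor // addrACA addxx add0r.
by move/(sum_freeP _): sfS; apply.
Qed.

(** A five-point slice is a neighbourhood [v + pent], and then [u + lincomb b v] is in [shifts] and
    supplies the extra unit. *)
Lemma size_slice u : (size [seq c <- codes 4 | (u + lincomb b c)%R \in S] <=
   4 + \sum_(c <- codes 4) ((u + lincomb b c)%R \in shifts))%N.
Proof.
set s := filter _ _; have ind : indep s := indep_slice u.
have := leq_size_indep ind; rewrite -/s leq_eqVlt => /orP[/eqP s5|].
  have := mem_combs (filter_subseq (fun c => u + lincomb b c \in S) (codes 4)).
  rewrite -/s s5 => /(allP indep_size5); rewrite ind => /hasP[v hv /allP hs].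
  rewrite (big_rem v hv) /= (_ : _ \in shifts) //.
  apply/shiftsP => e /hs; rewrite mem_filter => /andP[+ _].
  by rewrite lincomb_lxor // addrA.
by rewrite ltnS => h; apply: leq_trans h (leq_addr _ _).
Qed.

Lemma sum_translate (T : {set G}) (x : G) :
  (\sum_u ((u + x)%R \in T) = #|T|)%N.
Proof.
rewrite (reindex_inj (addIr x)) /= -sum1_card [RHS]big_mkcond /=.
by apply: eq_bigr => u _; rewrite (addxK addxx); case: (_ \in _).
Qed.

(** Sum [size_slice] over all [u]; every point is met 16 times. *)
Lemma leq_card_shifts : (16 * #|S| <= 4 * #|G| + 16 * #|shifts|)%N.
Proof.
have sum16 (T : {set G}) :
    (\sum_u \sum_(c <- codes 4) ((u + lincomb b c)%R \in T) = 16 * #|T|)%N.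
  rewrite exchange_big /=; under eq_bigr do rewrite sum_translate.
  by rewrite big_const_seq count_predT iter_addn_0 mulnC.
rewrite -!sum16 -[#|G|]sum1_card big_distrr -big_split /=.
by apply: leq_sum => u _; rewrite muln1 sum_nat_pred -size_filter size_slice.
Qed.

(* Were g = s1 + s2 + s3, every set u + <s1, s2, s3> + V would meet S in at   *)
(* most 33 of its 128 (possibly repeated) points.                             *)
Lemma shift_notin_sum3 g s1 s2 s3 : (17 * #|G| <= 64 * #|S|)%N ->
  g \in shifts -> s1 \in S -> s2 \in S -> s3 \in S -> g != s1 + s2 + s3.
Proof.
move=> dens /shiftsP gX s1S s2S s3S; apply/eqP => gE.
pose p (i : 'I_4) : G := nth 0 [:: 0; s1 + s2; s1 + s3; s2 + s3] i.
(* For distinct indices [p i + p j] is a sum of two of the [s1], [s2], [s3], and adding [g] leaves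
   the third. *)
have cross i j : i != j -> p i + (p j + g) \in S.
  have e3 : s1 + s2 + g = s3 by rewrite gE (addKx addxx).
  have e2 : s1 + s3 + g = s2 by rewrite gE (addrAC s1 s2) (addKx addxx).
  have e1 : s2 + s3 + g = s1 by rewrite gE -(addrA s1) [LHS]addrC (addxK addxx).
  have e12 : s1 + s2 + (s1 + s3) = s2 + s3.
    by rewrite addrACA addxx add0r.
  have e13 : s1 + s2 + (s2 + s3) = s1 + s3.
    by rewrite addrA (addxK addxx).
  have e23 : s1 + s3 + (s2 + s3) = s1 + s2.
    by rewrite (addrC s2) addrA (addxK addxx).
  case: i j => [[|[|[|[|//]]]] ?] [[|[|[|[|//]]]] ?] //= _; rewrite /p /=;
    rewrite ?add0r ?(addrA _ _ g) ?addr0 ?e12 ?e13 ?e23 ?e3 ?e2 ?e1 //;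
    rewrite ?[s1 + s3 + (s1 + s2)]addrC ?[s2 + s3 + (s1 + s2)]addrC
      ?[s2 + s3 + (s1 + s3)]addrC ?e12 ?e13 ?e23 ?e3 ?e2 ?e1 //.
have bound u : (\sum_(c <- codes 4) \sum_(i < 4)
   (((u + (p i + lincomb b c))%R \in S) + ((u + (p i + g + lincomb b c))%R \in S)) <= 33)%N.
  pose x (i : 'I_4) c := u + (p i + lincomb b c) \in S.
  pose x' (i : 'I_4) c := u + (p i + g + lincomb b c) \in S.
  pose U i := [pred c | x i c || x' i c].
  (* The slices at [u + p i] and [u + p i + g] have an independent union because both [pent] and its
     translate by [g] lie in [S]. *)
  have indU i : indep (filter (U i) (codes 4)).
    apply/allP => c; rewrite mem_filter => /andP[Uc hc].
    apply/allP => c'; rewrite mem_filter => /andP[Uc' hc'].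
    apply/negP => he; move/(sum_freeP _): (sfS) => sf.
    have se := pentS he; have sg := gX _ he.
    have := lincomb_lxor addxx b c c'; set v := lincomb b c; set v' := lincomb b c'.
    move=> vE; move: Uc Uc'; rewrite !inE /x /x' -/v -/v'.
    case/orP=> h1 /orP[] h2; have /negP := sf _ _ h1 h2; apply.
    + by rewrite addrACA addxx add0r addrACA addxx add0r -vE.
    + rewrite addrACA addxx add0r addrACA (addKx addxx) -vE //.
    + rewrite addrACA addxx add0r addrACA (addrAC (p i)) addxx add0r -vE //.
    + by rewrite addrACA addxx add0r addrACA addxx add0r -vE.
  apply: leq_trans (sum_weight indU); apply: leq_sum => c _.
  have xx' i j : i != j -> x i c -> x' j c = false.
    move=> ij xi; apply/negbTE/negP => xj; move/(sum_freeP _): (sfS) => sf.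
    have /negP := sf _ _ xi xj; apply.
    by rewrite addrACA addxx add0r addrACA addxx addr0 cross.
  (* By [xx'], if both points of one pair are present they are the only ones over [c]; otherwise
     each pair contributes at most one. *)
  case: (boolP [exists i, x i c && x' i c]) => [/existsP[i /andP[xi xi']]|].
    have h j : j != i -> x j c = false /\ x' j c = false.
      move=> ji; split; last by apply: xx' xi; rewrite eq_sym.
      by apply/negbTE/negP => /(xx' _ _ ji); rewrite xi'.
    rewrite (bigD1 i) //= -/(x i c) -/(x' i c) xi xi' big1 ?addn0; last first.
      by move=> j /h[]; rewrite /x /x' => -> ->.
    by rewrite (bigD1 i) //= xi add1n; apply: leq_maxr.
  rewrite negb_exists => /forallP nxx.
  rewrite (_ : \sum_(_ < _) _ = \sum_(i < 4) U i c)%N; last first.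
    apply: eq_bigr => i _; have := nxx i.
    by rewrite /= -/(x i c) -/(x' i c); case: (x i c); case: (x' i c).
  by case: (\sum_(_ < _) _)%N => // m; apply: leq_maxl.
have : (\sum_u \sum_(c <- codes 4) \sum_(i < 4)
   (((u + (p i + lincomb b c))%R \in S) + ((u + (p i + g + lincomb b c))%R \in S)) <=
   #|G| * 33)%N.
  by rewrite -sum_nat_const; apply: leq_sum => u _; apply: bound.
rewrite exchange_big /=.
under eq_bigr => c _.
  rewrite exchange_big /=.
  under eq_bigr do rewrite big_split /= !sum_translate.
  rewrite sum_nat_const card_ord.
  over.
rewrite /= big_const_seq count_predT iter_addn_0 /=.
have G0 : (0 < #|G|)%N by apply/card_gt0P; exists 0.
(* The sum gives 128 |S| <= 33 |G|, whereas 17/64 = 34/128. *)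
have arith (m k : nat) :
    (0 < m -> 17 * m <= 64 * k -> 4 * (k + k) * 16 <= m * 33 -> False)%N by lia.
exact: arith G0 dens.
Qed.

End Pentagon.

Section Stabiliser.
Variable G : finZmodType.
Hypothesis addxx : forall x : G, x + x = 0.
Variables (S : {set G}) (b : seq G).
Hypothesis sz_b : size b = 4%N.
Hypothesis pentS : {in pent, forall e, lincomb b e \in S}.
Hypothesis maxS : maxset (@sum_free G) S.
Hypothesis dens : (17 * #|G| <= 64 * #|S|)%N.

Let sfS : sum_free S.
Proof. by case/maxsetP: maxS. Qed.

Let X := shifts S b.

(** Since [g] is not a sum of three elements of [S], the union of [S] and its translate by [g] is
    sum-free, and maximality absorbs the translate. *)
Lemma addS_shifts s g : s \in S -> g \in X -> s + g \in S.
Proof.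
move=> sS gX; have no3 := shift_notin_sum3 addxx sfS sz_b pentS dens gX.
pose S' := S :|: [set s + g | s in S].
have memS' x : (x \in S') = (x \in S) || (x + g \in S).
  rewrite inE; congr orb; apply/imsetP/idP => [[y yS ->]|xgS].
    by rewrite (addxK addxx).
  by exists (x + g); rewrite ?(addxK addxx).
suff sfS' : sum_free S'.
  have [_ maxS'] := maxsetP maxS.
  by rewrite -(maxS' S' sfS' (subsetUl _ _)) memS' (addxK addxx) sS orbT.
move/(sum_freeP _): sfS => sf; apply/sum_freeP => x y.
have no3' u v : u \in S -> v \in S -> u + v + g \notin S.
  move=> uS vS; apply/negP => h; have /negP := no3 _ _ _ uS vS h; apply.
  by rewrite addrA addxx add0r.
rewrite !memS' => /orP[] hx /orP[] hy; rewrite negb_or.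
- by rewrite (sf _ _ hx hy) (no3' _ _ hx hy).
- rewrite -(addrA x) (sf _ _ hx hy) andbT.
  by have := no3' _ _ hx hy; rewrite addrA (addxK addxx).
- rewrite (addrAC x y) (sf _ _ hx hy) andbT.
  by have := no3' _ _ hx hy; rewrite (addrAC x g) (addxK addxx).
- have -> : x + y = (x + g) + (y + g) by rewrite addrACA addxx addr0.
  by rewrite (sf _ _ hx hy) (no3' _ _ hx hy).
Qed.

Lemma addS_shiftsE s g : g \in X -> (s + g \in S) = (s \in S).
Proof.
move=> gX; apply/idP/idP => [h|h]; last exact: addS_shifts.
by rewrite -[s](addxK addxx _ g) addS_shifts.
Qed.

Lemma frame_shifts : frame b X.
Proof.
split=> [|g h gX hX|c].
- exact: shifts0.
- apply/shiftsP => e he; rewrite -addrA addrC; apply: addS_shifts => //.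
  by move/shiftsP: hX; apply.
rewrite sz_b => hc /shiftsP hX; apply/eqP; apply: contraT => c0.
case/orP: (allP code_pent_shift _ hc) => [/idPn//|].
case/hasP=> e he /hasP[e1 h1 /hasP[e2 h2 /eqP E]].
move: (hX _ he); rewrite -lincomb_lxor // E lincomb_lxor //.
by move/(sum_freeP _): (sfS) => sf; rewrite (negbTE (sf _ _ (pentS h1) (pentS h2))).
Qed.

Lemma mem_lincomb_shift c x : c \in codes 4 -> x \in X ->
  (lincomb b c + x \in S) = (c \in pent).
Proof.
move=> hc xX; rewrite addS_shiftsE //; apply/idP/idP => [|/pentS//].
by apply: contraTT; apply: lincomb_notin.
Qed.

(** 17/64 - 1/4 = 1/64, and [leq_card_shifts] charges this excess to X. *)
Lemma shifts_dens : (#|G| <= 64 * #|X|)%N.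
Proof.
have arith (m k x : nat) :
    (17 * m <= 64 * k -> 16 * k <= 4 * m + 16 * x -> m <= 64 * x)%N by lia.
exact: arith dens (leq_card_shifts addxx sfS pentS).
Qed.

End Stabiliser.

(** * Maximal sets of index 2 and 4 *)

Definition code_reps (M : seq N) (v : N) : nat :=
  count (fun a => N.lxor v a \in M) M.

(** The energy as a sum of squared representation numbers, which is cheaper to evaluate than the sum
    of [code_quads]. *)
Definition code_energy (d : nat) (M : seq N) : nat :=
  sumn [seq code_reps M v ^ 2 | v <- codes d]%N.

Lemma code_quadsE M c :
  code_quads M c = sumn [seq code_reps M (N.lxor c a) | a <- M].
Proof.
rewrite sumnE big_map; apply: eq_bigr => a _; rewrite sum_nat_pred.
by apply: eq_count => b; rewrite /= N.lxor_assoc.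
Qed.

Lemma code_energyE d M : uniq M -> {subset M <= codes d} ->
  (\sum_(c <- M) code_quads M c = code_energy d M)%N.
Proof.
move=> uM sM; rewrite /code_energy sumnE big_map.
transitivity (\sum_(c <- M) \sum_(a <- M) \sum_(v <- codes d)
    (v == N.lxor c a) * code_reps M v)%N.
  apply: eq_big_seq => c cM; rewrite code_quadsE sumnE big_map.
  apply: eq_big_seq => a aM; have hv := codes_lxor (sM _ cM) (sM _ aM).
  rewrite (bigD1_seq _ hv (codes_uniq d)) /= eqxx mul1n big1 ?addn0 // => v.
  by move/negbTE->.
under eq_bigr do rewrite exchange_big.
rewrite exchange_big /=; apply: eq_bigr => v _.
under eq_bigr do rewrite -big_distrl.
rewrite -big_distrl /= -mulnn; congr (_ * _)%N.
rewrite /code_reps -sum_nat_pred; apply: eq_bigr => c _.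
rewrite -[in RHS](count_uniq_mem _ uM) -sum_nat_pred.
apply: eq_bigr => a _; congr nat_of_bool; apply/eqP/eqP => ->.
  by rewrite (N.lxor_comm _ c) lxorKl.
by rewrite (N.lxor_comm v) lxorKl.
Qed.

(** The [if] stops at the first match under call-by-value evaluation, where a disjunction would scan
    the whole list. *)
Fixpoint memN (c : N) (s : seq N) : bool :=
  if s is a :: s' then (if N.eqb a c then true else memN c s') else false.

Lemma memNE c s : memN c s = (c \in s).
Proof.
elim: s => //= a s ->; rewrite inE eq_sym -[a == c]/(N.eqb a c).
by case: N.eqb.
Qed.

Definition slices : seq (seq N) := [seq s <- combs (codes 4) 4 | indep s].

(** Up to translation an independent 4-set is of one of two types: four points of the pentagon, or a
    subgroup of order 4. *)
Definition canon : seq (seq N) := [seq s <- slices |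
  all (mem pent) s || all (fun a => all (fun a' => N.lxor a a' \in s) s) s].

Lemma slices_canon : all (fun s =>
  has (fun a => [seq c <- codes 4 | N.lxor a c \in s] \in canon) (codes 4)) slices.
Proof. by vm_compute. Qed.

Definition tops : seq N := [:: 0; 16; 32; 48]%num.

Lemma tops_inj : all (fun h => all (fun h' => all (fun c => all (fun c' =>
  (N.lxor h c == N.lxor h' c') == (h == h') && (c == c')) (codes 4)) (codes 4))
  tops) tops.
Proof. by vm_compute. Qed.

Lemma codes6E : codes 6 = flatten [seq map (N.lxor h) (codes 4) | h <- tops].
Proof. by vm_compute. Qed.

(** Assembles a subset of F_2^6 from its slices in the four cosets of F_2^4, so that representations
    can be counted slice by slice. *)
Definition glue (sl : N -> seq N) : seq N :=
  flatten [seq map (N.lxor h) (sl h) | h <- tops].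

Lemma mem_glue sl h c : (forall h, {subset sl h <= codes 4}) ->
  h \in tops -> c \in codes 4 -> (N.lxor h c \in glue sl) = (c \in sl h).
Proof.
move=> ssl hh hc; apply/flatten_mapP/idP => [[h' hh' /mapP[c' hc' E]]|cs].
  have := allP (allP (allP (allP tops_inj h hh) h' hh') c hc) c' (ssl _ _ hc').
  by rewrite E eqxx => /eqP/esym/andP[/eqP-> /eqP->].
by exists h => //; apply: map_f.
Qed.

Definition glue_reps (sl : N -> seq N) (h v : N) : nat :=
  sumn [seq count (fun a => memN (N.lxor v a) (sl (N.lxor h h'))) (sl h')
    | h' <- tops].

Lemma lxor_tops : all (fun h => all (fun h' => N.lxor h h' \in tops) tops) tops.
Proof. by []. Qed.

Lemma code_reps_glue sl h v : (forall h, {subset sl h <= codes 4}) ->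
  h \in tops -> v \in codes 4 -> code_reps (glue sl) (N.lxor h v) = glue_reps sl h v.
Proof.
move=> ssl hh hv; rewrite /code_reps count_flatten -map_comp; congr sumn.
apply/eq_in_map => h' hh' /=; rewrite count_map; apply: eq_in_count => a ha /=.
rewrite memNE -(mem_glue ssl (allP (allP lxor_tops h hh) h' hh')); last first.
  exact: codes_lxor hv (ssl _ _ ha).
rewrite (_ : N.lxor (N.lxor h v) _ = N.lxor (N.lxor h h') (N.lxor v a)) //.
by apply: N.bits_inj => i; rewrite !N.lxor_spec; do 4!case: N.testbit.
Qed.

Definition glue_energy (sl : N -> seq N) : nat :=
  sumn [seq sumn [seq glue_reps sl h v ^ 2 | v <- codes 4] | h <- tops]%N.

Lemma code_energy_glue sl : (forall h, {subset sl h <= codes 4}) ->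
  code_energy 6 (glue sl) = glue_energy sl.
Proof.
move=> ssl; rewrite /code_energy codes6E map_flatten sumn_flatten -!map_comp.
congr sumn; apply/eq_in_map => h hh.
rewrite -[LHS]/(sumn (map _ (map (N.lxor h) (codes 4)))) -map_comp; congr sumn.
by apply/eq_in_map => v hv; rewrite -code_reps_glue.
Qed.

Definition slices4 (sx sy sz : seq N) (h : N) : seq N :=
  match h with 0 => pent | 16 => sx | 32 => sy | 48 => sz | _ => [::] end%num.

Definition slices2 (sx : seq N) : N -> seq N := slices4 sx [::] [::].

(* The product of the pentagon and F_2^2, without three points that have      *)
(* different projections to the pentagon.                                     *)
Definition pent17 : seq N :=
  filter (fun c => (c \notin [:: 1; 2; 4]%num) && (N.land c 15 \in pent)) (codes 6).

Lemma energy_pent : code_energy 4 pent = 65%N.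
Proof. by vm_compute. Qed.

Lemma energy_pent17 : code_energy 6 pent17 = 2249%N.
Proof. by vm_compute. Qed.

Lemma sum_free_pent : all (fun a => all (fun a' => N.lxor a a' \notin pent) pent) pent.
Proof. by vm_compute. Qed.

Lemma sum_free_pent17 :
  all (fun a => all (fun a' => N.lxor a a' \notin pent17) pent17) pent17.
Proof. by vm_compute. Qed.

(** In the exceptional case [sx] is a subgroup of order 4; the constants 393 and 49 are what
    [index2_contra] refutes. *)
Lemma slices_index2 : all (fun sx => all (mem pent) sx ||
  (code_energy 5 (glue (slices2 sx)) == 393%N) &&
    all (fun c => sumn [seq code_reps (glue (slices2 sx)) (N.lxor c a)
          | a <- glue (slices2 sx)] <= 49)%N (glue (slices2 sx))) canon.
Proof. by vm_compute. Qed.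

(** The room left for the slice at [x + y]: adding a point over [x] to one over [x + y] gives a
    point over [y], which must avoid the set. *)
Definition disjoint_sums (sx sy : seq N) : seq N :=
  [seq c <- codes 4 | all (fun a => ~~ memN (N.lxor a c) sy) sx].

(** The threshold 2273 exceeds 2249, the energy of [pent17]. The nested [if] avoids computing
    energies of excluded configurations. *)
Lemma slices_index4 : all (fun sx => all (fun sy => all (fun sz =>
    if indep sz then
      if all (mem pent) (sx ++ sy ++ sz) then true
      else (2273 <= glue_energy (slices4 sx sy sz))%N
    else true)
  (combs (disjoint_sums sx sy) 4)) canon) canon.
Proof. by vm_compute. Qed.

(** A coordinate-free form of the conclusion: [L] is a quotient map onto F_2^4 and [S] lies over the
    pentagon. *)
Definition pent_map (G : finZmodType) (S : {set G}) (L : G -> N) : Prop :=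
  [/\ {morph L : g h / g + h >-> N.lxor g h}, forall g, L g \in codes 4,
      forall c, c \in codes 4 -> exists g, L g = c
    & {in S, forall s, L s \in pent}].

Lemma codes4_land : all (fun c => N.land c 15 == c) (codes 4).
Proof. by vm_compute. Qed.

Lemma codes5E : codes 5 = flatten [seq map (N.lxor h) (codes 4) | h <- [:: 0; 16]%num].
Proof. by vm_compute. Qed.

Lemma pentE : pent = filter (mem pent) (codes 4).
Proof. by vm_compute. Qed.

(** * Coordinates relative to a frame, and slices *)

Section Frames.
Variable G : finZmodType.
Hypothesis addxx : forall x : G, x + x = 0.
Implicit Types (S X : {set G}) (b : seq G) (M : seq N).

Lemma pent_map_frame b X S : frame b X -> (4 <= size b)%N ->
  (#|G| <= 2 ^ size b * #|X|)%N ->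
  {in S, forall s, exists c, [/\ c \in codes (size b), s + lincomb b c \in X
     & N.land c 15 \in pent]} ->
  exists L, pent_map S L.
Proof.
move=> fr sz_b cardG hS; set d := size b in sz_b cardG hS *.
have hsp := frame_span addxx fr cardG.
(* [cd g] is the coordinate vector of [g] modulo [X]; the default is never reached because the frame
   spans. The mask 15 below keeps the first four coordinates. *)
pose cd g := nth 0%num (codes d) (find (fun c => g + lincomb b c \in X) (codes d)).
have cdP g : cd g \in codes d /\ g + lincomb b (cd g) \in X.
  have hg : has (fun c => g + lincomb b c \in X) (codes d).
    by have [c hc gX] := hsp g; apply/hasP; exists c.
  split; last exact: (nth_find 0%num hg).
  by rewrite mem_nth // -has_find.
have cdE g c : c \in codes d -> g + lincomb b c \in X -> cd g = c.
  move=> hc gX; have [h1 h2] := cdP g; apply: (frame_inj addxx fr) => //.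
  case: fr => _ XD _; have := XD _ _ h2 gX.
  by rewrite addrACA addxx add0r.
exists (fun g => N.land (cd g) 15); split.
- move=> g h; have [hg gX] := cdP g; have [hh hX] := cdP h.
  rewrite (cdE (g + h) (N.lxor (cd g) (cd h))).
  + apply: N.bits_inj => i; rewrite !(N.land_spec, N.lxor_spec).
    by do 3!case: N.testbit.
  + exact: codes_lxor.
  + rewrite lincomb_lxor // addrACA.
    by case: fr => _ XD _; apply: XD.
- move=> g; apply: codes_testbit => i le_i; rewrite N.land_spec.
  by rewrite (@testbit_codes 4 15%num) // andbF.
- move=> c hc; exists (lincomb b c); rewrite (cdE _ c).
  + exact/eqP/(allP codes4_land).
  + exact: codes_leq hc.
  + by rewrite addxx; case: fr.
- by move=> s /hS[c [hc sX hp]]; rewrite (cdE _ c).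
Qed.

Lemma frame_not_span b X : frame b X -> (2 ^ size b * #|X| < #|G|)%N ->
  exists y, forall c, c \in codes (size b) -> y + lincomb b c \notin X.
Proof.
move=> fr lt_G; have [y hy] : exists y, y \notin blowup b X (codes (size b)).
  apply/existsP; apply: contraLR lt_G; rewrite negb_exists => /forallP h.
  rewrite -leqNgt -[(2 ^ _)%N](size_iota 0) -(size_map N.of_nat).
  rewrite -(card_blowup addxx fr (codes_uniq _)) //.
  apply: subset_leq_card; apply/subsetP => y _.
  by have := h y; rewrite negbK.
exists y => c hc; apply: contra hy => hX; rewrite inE.
by apply/hasP; exists c.
Qed.

Lemma lincomb_rcons_low b y c :
  c \in codes (size b) -> lincomb (rcons b y) c = lincomb b c.
Proof. by move=> hc; rewrite lincomb_rcons (testbit_codes hc) // addr0. Qed.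

Lemma lincomb_rcons_top b y :
  lincomb (rcons b y) (2 ^ N.of_nat (size b)) = y.
Proof.
rewrite lincomb_rcons N.pow2_bits_true /lincomb big1 ?add0r // => i _.
rewrite N.pow2_bits_false // => /Nat2N.inj e.
by have := ltn_ord i; rewrite -e ltnn.
Qed.

End Frames.

Section Slices.
Variable G : finZmodType.
Hypothesis addxx : forall x : G, x + x = 0.
Variables (T : {set G}) (b : seq G).
Hypothesis sz_b : size b = 4%N.
Hypothesis pentT : {in pent, forall e, lincomb b e \in T}.
Hypothesis maxT : maxset (@sum_free G) T.
Hypothesis dens : (17 * #|G| <= 64 * #|T|)%N.

Let X := shifts T b.
Let sfT : sum_free T.
Proof. by case/maxsetP: maxT. Qed.
Let fr : frame b X.
Proof. exact: (frame_shifts addxx sz_b pentT maxT dens). Qed.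

Definition slice (u : G) : seq N := [seq c <- codes 4 | u + lincomb b c \in T].

Lemma slice_codes u : {subset slice u <= codes 4}.
Proof. by move=> c; rewrite mem_filter => /andP[]. Qed.

Lemma slice0 : slice 0 = pent.
Proof.
rewrite [RHS]pentE; apply: eq_in_filter => c hc; rewrite add0r /=.
have := mem_lincomb_shift addxx sz_b pentT maxT dens hc (shifts0 pentT).
by rewrite addr0.
Qed.

Lemma leq_size_slice u : (forall c, c \in codes 4 -> u + lincomb b c \notin X) ->
  (size (slice u) <= 4)%N.
Proof.
move=> hu; apply: leq_trans (size_slice addxx sfT pentT u) _.
by rewrite big1_seq // => c /andP[_ hc]; rewrite (negbTE (hu c hc)).
Qed.

Lemma slice_slices u : size (slice u) = 4%N -> slice u \in slices.
Proof.
move=> sz; rewrite mem_filter (indep_slice addxx sfT pentT) /=.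
have := mem_combs (filter_subseq (fun c => u + lincomb b c \in T) (codes 4)).
by rewrite -/(slice u) sz.
Qed.

(** Moving the representative within its coset of V translates the slice. *)
Lemma slice_canon u : size (slice u) = 4%N ->
  exists2 a, a \in codes 4 & slice (u + lincomb b a) \in canon.
Proof.
move=> /slice_slices/(allP slices_canon)/hasP[a ha hc]; exists a => //.
rewrite (_ : slice _ = [seq c <- codes 4 | N.lxor a c \in slice u]) //.
apply: eq_in_filter => c hc'; rewrite mem_filter codes_lxor // andbT.
by rewrite lincomb_lxor // addrA.
Qed.

(** X stabilises [T], so [T] is a union of cosets of X. *)
Lemma max_blowup b' : frame b' X -> (#|G| <= 2 ^ size b' * #|X|)%N ->
  T = blowup b' X [seq c <- codes (size b') | lincomb b' c \in T].
Proof.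
move=> fr' cardG; apply/setP => g; rewrite inE.
have addXE s x : x \in X -> (s + x \in T) = (s \in T).
  by move=> xX; apply: (addS_shiftsE addxx sz_b pentT maxT dens).
apply/idP/hasP => [gT|[c]].
  have [c hc gX] := frame_span addxx fr' cardG g.
  exists c => //; rewrite mem_filter hc andbT -(addXE _ _ gX).
  by rewrite addrC (addxK addxx).
rewrite mem_filter => /andP[cT hc] gX.
by rewrite -(addXE _ _ gX) (addKx addxx).
Qed.

Lemma filter_shift b' h :
  (forall c, c \in codes 4 -> lincomb b' c = lincomb b c) ->
  [seq c <- map (N.lxor h) (codes 4) | lincomb b' c \in T] =
  map (N.lxor h) (slice (lincomb b' h)).
Proof.
move=> hb'; rewrite filter_map; congr map; apply: eq_in_filter => c hc /=.
by rewrite lincomb_lxor // (hb' c).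
Qed.

Lemma glue_index2 x :
  [seq c <- codes 5 | lincomb (rcons b x) c \in T] = glue (slices2 (slice x)).
Proof.
have hb c : c \in codes 4 -> lincomb (rcons b x) c = lincomb b c.
  by rewrite -sz_b; apply: lincomb_rcons_low.
have x16 : lincomb (rcons b x) 16 = x.
  by rewrite -[RHS](lincomb_rcons_top b x) sz_b.
rewrite codes5E filter_flatten -map_comp.
rewrite (eq_map (g := fun h => map (N.lxor h) (slice (lincomb (rcons b x) h)))).
  by rewrite /glue /= x16 lincomb0 slice0.
by move=> h; rewrite /comp filter_shift.
Qed.

Lemma glue_index4 x y :
  [seq c <- codes 6 | lincomb (rcons (rcons b x) y) c \in T] =
  glue (slices4 (slice x) (slice y) (slice (x + y))).
Proof.
have hb5 c : c \in codes 4 -> lincomb (rcons b x) c = lincomb b c.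
  by rewrite -sz_b; apply: lincomb_rcons_low.
have hb6 c : c \in codes 5 ->
    lincomb (rcons (rcons b x) y) c = lincomb (rcons b x) c.
  by move=> hc; apply: lincomb_rcons_low; rewrite size_rcons sz_b.
have x16 : lincomb (rcons (rcons b x) y) 16 = x.
  by rewrite hb6 // -[RHS](lincomb_rcons_top b x) sz_b.
have y32 : lincomb (rcons (rcons b x) y) 32 = y.
  by rewrite -[RHS](lincomb_rcons_top (rcons b x) y) size_rcons sz_b.
have xy48 : lincomb (rcons (rcons b x) y) 48 = x + y.
  by rewrite -[48%num]/(N.lxor 16 32) lincomb_lxor // x16 y32.
rewrite codes6E filter_flatten -map_comp.
rewrite (eq_map (g := fun h => map (N.lxor h) (slice (lincomb (rcons (rcons b x) y) h)))).
  by rewrite /glue /= x16 y32 xy48 lincomb0 slice0.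
move=> h; rewrite /comp filter_shift // => c hc.
by rewrite hb6 ?hb5 //; apply: codes_leq hc.
Qed.

End Slices.

(** * Polynomial inequalities *)

Section Arithmetic.
Local Open Scope Z_scope.

(* For N = 32 k the reference set has 10 k points, energy 520 k^3 and [AP]    *)
(* words of length 4.                                                         *)
Lemma greedy_cancel (k n A AP : Z) : 0 < k ->
  520 * k ^ 3 + 20 * k = 24 * AP + 300 * k ^ 2 ->
  A * (10 * k) ^ 4 <= AP * n ^ 4 ->
  12000 * A * k ^ 3 <= (26 * k ^ 2 - 15 * k + 1) * n ^ 4.
Proof.
intros k0 hAP hA.
apply (Z.mul_le_mono_pos_r _ _ (20 * k)); [lia|].
replace (12000 * A * k ^ 3 * (20 * k)) with (24 * (A * (10 * k) ^ 4)) by ring.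
replace ((26 * k ^ 2 - 15 * k + 1) * n ^ 4 * (20 * k))
  with ((520 * k ^ 3 + 20 * k - 300 * k ^ 2) * n ^ 4) by ring.
rewrite hAP.
replace ((24 * AP + 300 * k ^ 2 - 300 * k ^ 2) * n ^ 4) with (24 * (AP * n ^ 4)) by ring.
lia.
Qed.

(** The reverse of [energy_no_pentagon] for |G| = 32 k. For large [k] the leading terms compare
    1.664 n^4 with 2 n^4; [h2] is the inequality left after inserting [greedy_cancel], with [k = 1]
    checked apart. *)
Lemma energy_boundZ (k n A AP E : Z) : 0 < k -> 17 * k <= 2 * n ->
  n <= 10 * k ->
  520 * k ^ 3 + 20 * k = 24 * AP + 300 * k ^ 2 ->
  A * (10 * k) ^ 4 <= AP * n ^ 4 ->
  E + 2 * n = 24 * A + 3 * n ^ 2 ->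
  32 * k * E < 2 * n ^ 4.
Proof.
intros k0 lo hi hAP hA hE.
pose proof (@greedy_cancel k n A AP k0 hAP hA) as h1.
assert (h2 : 8000 * k ^ 3 * (3 * n - 2) < n ^ 3 * (84 * k ^ 2 + 240 * k - 16)).
{ assert (k = 1 \/ 2 <= k) as [->|k2] by lia.
  - assert (n = 9 \/ n = 10) as [->| ->] by lia; lia.
  - assert (hn : 289 * k ^ 2 <= 4 * n ^ 2) by nia.
    assert (h3 : 0 < 84 * k ^ 2 + 240 * k - 16) by nia.
    assert (h4 : 289 * k ^ 2 * (n * (84 * k ^ 2 + 240 * k - 16)) <=
                 4 * n ^ 2 * (n * (84 * k ^ 2 + 240 * k - 16)))
      by (apply Z.mul_le_mono_nonneg_r; nia).
    assert (h5 : 0 < n * k ^ 2 * (6069 * k ^ 2 - 6660 * k + 444))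
      by (apply Z.mul_pos_pos; nia).
    assert (h6 : k ^ 2 * n <= k ^ 2 * (10 * k))
      by (apply Z.mul_le_mono_nonneg_l; nia).
    replace (n ^ 3) with (n ^ 2 * n) by ring.
    replace (k ^ 3) with (k ^ 2 * k) by ring.
    lia. }
assert (h3 : 16 * k * E * (500 * k ^ 2) < n ^ 4 * (500 * k ^ 2)).
{ assert (n0 : 0 < n) by lia.
  pose proof (proj1 (Z.mul_lt_mono_pos_r n _ _ n0) h2) as h4.
  replace E with (24 * A + 3 * n ^ 2 - 2 * n) by lia.
  replace (16 * k * (24 * A + 3 * n ^ 2 - 2 * n) * (500 * k ^ 2)) with
    (16 * (12000 * A * k ^ 3) + 8000 * k ^ 3 * (3 * n - 2) * n) by ring.
  replace (n ^ 4 * (500 * k ^ 2)) with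
    (16 * ((26 * k ^ 2 - 15 * k + 1) * n ^ 4) +
     n ^ 3 * (84 * k ^ 2 + 240 * k - 16) * n) by ring.
  lia. }
assert (16 * k * E < n ^ 4) by (apply (Z.mul_lt_mono_pos_r (500 * k ^ 2)); nia).
lia.
Qed.

Lemma chain_bound (q r l a u v : Z) : 0 < u -> 0 <= q -> r <= 24 * a ->
  12000 * a * u <= q * v -> 8 * v <= u * l -> 4000 * r <= q * l.
Proof.
intros u0 q0 hr hq hv.
apply (Z.mul_le_mono_pos_r _ _ u); [assumption|].
assert (q * (8 * v) <= q * (u * l)) by (apply Z.mul_le_mono_nonneg_l; assumption).
assert (r * u <= 24 * a * u) by (apply Z.mul_le_mono_nonneg_r; lia).
lia.
Qed.

(* For index 2 the maximal set has 9 k points, energy 393 k^3, [AT] words of  *)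
(* length 4 and at most [D] of them through each point.                       *)
Lemma index2_contraZ (k n AT A D AP : Z) : 0 < k -> 17 * k <= 2 * n ->
  n <= 9 * k -> 0 <= D ->
  393 * k ^ 3 + 18 * k = 24 * AT + 243 * k ^ 2 ->
  AT <= A + (9 * k - n) * D ->
  6 * D + 27 * k <= 49 * k ^ 2 + 2 ->
  520 * k ^ 3 + 20 * k = 24 * AP + 300 * k ^ 2 ->
  A * (10 * k) ^ 4 <= AP * n ^ 4 -> False.
Proof.
intros k0 lo hi D0 hAT hle hD hAP hA.
pose proof (@greedy_cancel k n A AP k0 hAP hA) as h1.
(* By convexity n^4 lies below its chord between n = 17 k / 2 and n = 9 k; the factorisation makes
   this explicit and the bound linear in [n]. *)
assert (h2 : 8 * n ^ 4 <= k ^ 3 * (21455 * n - 140607 * k)).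
{ assert (0 <= (2 * n - 17 * k) * (9 * k - n) * (4 * n ^ 2 + 70 * n * k + 919 * k ^ 2))
    by (repeat apply Z.mul_nonneg_nonneg; [lia|lia|clear - k0 lo; nia]).
  replace (8 * n ^ 4) with (k ^ 3 * (21455 * n - 140607 * k) -
    (2 * n - 17 * k) * (9 * k - n) * (4 * n ^ 2 + 70 * n * k + 919 * k ^ 2)) by ring.
  lia. }
assert (h3 : 6 * ((9 * k - n) * D) <= (9 * k - n) * (49 * k ^ 2 + 2 - 27 * k)).
{ replace (6 * ((9 * k - n) * D)) with ((9 * k - n) * (6 * D)) by ring.
  apply Z.mul_le_mono_nonneg_l; lia. }
assert (h4 : 4000 * (393 * k ^ 3 - 243 * k ^ 2 + 18 * k
   - 4 * ((9 * k - n) * (49 * k ^ 2 + 2 - 27 * k))) <=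
   (26 * k ^ 2 - 15 * k + 1) * (21455 * n - 140607 * k)).
{ apply (@chain_bound _ _ _ A (k ^ 3) (n ^ 4)); try assumption.
  - clear - k0; nia.
  - clear - k0; nia.
  - clear - hAT hle h3; lia. }
assert (k = 1 \/ 2 <= k) as [->|k2] by lia.
{ assert (n = 9) as -> by lia. lia. }
(* What remains is linear in [n], and the worst case is the endpoint n = 17 k / 2, where 18 k - 2 n
   = k. *)
assert (h5 : (18 * k - 2 * n) * (226170 * k ^ 2 - 110175 * k + 10545) <=
  k * (226170 * k ^ 2 - 110175 * k + 10545)) 
  by (apply Z.mul_le_mono_nonneg_r; [clear - k2; nia|lia]).
assert (h6 : 0 < k * (188454 * k ^ 2 - 259185 * k + 28479))
  by (apply Z.mul_pos_pos; clear - k2; nia).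
lia.
Qed.

Lemma energy_bound (k n A AP E : nat) : (0 < k -> 17 * k <= 2 * n ->
  n <= 10 * k ->
  520 * k ^ 3 + 20 * k = 24 * AP + 300 * k ^ 2 ->
  A * (10 * k) ^ 4 <= AP * n ^ 4 ->
  E + 2 * n = 24 * A + 3 * n ^ 2 ->
  32 * k * E < 2 * n ^ 4)%N.
Proof.
move=> k0 lo hi hAP hA hE.
have := @energy_boundZ (Z.of_nat k) (Z.of_nat n) (Z.of_nat A) (Z.of_nat AP) (Z.of_nat E).
move=> h; suff: (32 * Z.of_nat k * Z.of_nat E < 2 * Z.of_nat n ^ 4) by clear; lia.
apply: h; [clear -k0|clear -lo|clear -hi|clear -hAP|clear -hA|clear -hE]; lia.
Qed.

Lemma index2_contra (k n AT A D AP : nat) : (0 < k -> 17 * k <= 2 * n ->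
  n <= 9 * k ->
  393 * k ^ 3 + 18 * k = 24 * AT + 243 * k ^ 2 ->
  AT <= A + (9 * k - n) * D ->
  6 * D + 27 * k <= 49 * k ^ 2 + 2 ->
  520 * k ^ 3 + 20 * k = 24 * AP + 300 * k ^ 2 ->
  A * (10 * k) ^ 4 <= AP * n ^ 4 -> False)%N.
Proof.
move=> k0 lo hi hAT hle hD hAP hA.
apply: (@index2_contraZ (Z.of_nat k) (Z.of_nat n) (Z.of_nat AT) (Z.of_nat A)
  (Z.of_nat D) (Z.of_nat AP)).
- by clear -k0; lia.
- by clear -lo; lia.
- by clear -hi; lia.
- by clear; lia.
- by clear -hAT; lia.
- have [m mE] : exists m, (9 * k = n + m)%N by exists (9 * k - n)%N; rewrite subnKC.
  have -> : (9 * Z.of_nat k - Z.of_nat n = Z.of_nat m) by clear -mE; lia.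
  by move: hle; rewrite mE addKn; clear; lia.
- by clear -hD; lia.
- by clear -hAP; lia.
- by clear -hA; lia.
Qed.

End Arithmetic.

Lemma land_tops : all (fun h => all (fun e => N.land (N.lxor h e) 15 \in pent) pent) tops.
Proof. by vm_compute. Qed.

Lemma glue_pent sl c : (forall h, h \in tops -> all (mem pent) (sl h)) ->
  c \in glue sl -> N.land c 15 \in pent.
Proof.
move=> hsl /flatten_mapP[h hh /mapP[c' hc' ->]].
exact: (allP (allP land_tops h hh) c' (allP (hsl h hh) c' hc')).
Qed.

Lemma size_glue sx sy sz :
  size (glue (slices4 sx sy sz)) = (5 + size sx + size sy + size sz)%N.
Proof.
by rewrite size_flatten /shape -map_comp /= !size_map; lia.
Qed.

Lemma slices4_codes sx sy sz : {subset sx <= codes 4} ->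
  {subset sy <= codes 4} -> {subset sz <= codes 4} ->
  forall h, {subset slices4 sx sy sz h <= codes 4}.
Proof.
move=> hx hy hz h; rewrite /slices4; case: h => [|h]; first exact: pent_codes.
by do 6? [case: h => [h|h|] //].
Qed.

Lemma pent17_codes : {subset pent17 <= codes 6}.
Proof. by apply: mem_subseq; apply: filter_subseq. Qed.

(** * Maximal sets according to the index of V + X *)

Section Contained.
Variable G : finZmodType.
Hypothesis addxx : forall x : G, x + x = 0.
Variables (T : {set G}) (b : seq G).
Hypothesis sz_b : size b = 4%N.
Hypothesis pentT : {in pent, forall e, lincomb b e \in T}.
Hypothesis maxT : maxset (@sum_free G) T.
Hypothesis dens : (17 * #|G| <= 64 * #|T|)%N.

Let X := shifts T b.
Let sfT : sum_free T.
Proof. by case/maxsetP: maxT. Qed.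
Let fr : frame b X.
Proof. exact: (frame_shifts addxx sz_b pentT maxT dens). Qed.

Lemma pent_map_max b' : frame b' X -> (4 <= size b')%N ->
  (#|G| <= 2 ^ size b' * #|X|)%N ->
  (forall c, c \in codes (size b') -> lincomb b' c \in T -> N.land c 15 \in pent) ->
  exists L, pent_map T L.
Proof.
move=> fr' sz' cardG hp; apply: (pent_map_frame addxx fr' sz' cardG) => t.
rewrite {1}(max_blowup addxx sz_b pentT maxT dens fr' cardG) inE.
case/hasP=> c; rewrite mem_filter => /andP[cT hc] tX.
by exists c; split=> //; apply: hp.
Qed.

Lemma pent_map_index1 : (#|G| <= 16 * #|X|)%N -> exists L, pent_map T L.
Proof.
move=> cardG; apply: (pent_map_max fr); rewrite ?sz_b // => c hc cT.
have /eqP -> := allP codes4_land c hc.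
by apply: contraLR cT => cp; apply: (lincomb_notin addxx sfT pentT).
Qed.

Lemma card_X_gt0 : (0 < #|X|)%N.
Proof. by apply/card_gt0P; exists 0; apply: shifts0. Qed.

Lemma index2_frame x : (forall c, c \in codes 4 -> x + lincomb b c \notin X) ->
  frame (rcons b x) X.
Proof. by move=> hx; apply: frame_rcons; rewrite ?sz_b. Qed.

Lemma pent_map_index2 : (16 * #|X| < #|G|)%N -> (#|G| <= 32 * #|X|)%N ->
  #|G| = (32 * #|X|)%N /\
  ((exists L, pent_map T L) \/
   [/\ #|T| = (9 * #|X|)%N, energy T = (393 * #|X| ^ 3)%N
     & forall s, s \in T -> (quads T s <= 49 * #|X| ^ 2)%N]).
Proof.
move=> lo hi.
have lo4 : (2 ^ size b * #|X| < #|G|)%N by rewrite sz_b.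
have [x0] := frame_not_span addxx fr lo4; rewrite sz_b => hx0.
have cardG x : (forall c, c \in codes 4 -> x + lincomb b c \notin X) ->
    #|G| = (32 * #|X|)%N.
  move=> /index2_frame fr5; apply/eqP; rewrite eqn_leq hi /=.
  by have := frame_card addxx fr5; rewrite size_rcons sz_b.
have cardT x : (forall c, c \in codes 4 -> x + lincomb b c \notin X) ->
    #|T| = ((5 + size (slice T b x)) * #|X|)%N.
  move=> hx; have fr5 := index2_frame hx.
  rewrite {1}(max_blowup addxx sz_b pentT maxT dens fr5); last first.
    by rewrite size_rcons sz_b.
  rewrite size_rcons sz_b card_blowup ?filter_uniq ?codes_uniq //.
    by rewrite (glue_index2 addxx sz_b pentT maxT dens) size_glue !addn0.
  by move=> c; rewrite mem_filter size_rcons sz_b => /andP[].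
have size_sl x : (forall c, c \in codes 4 -> x + lincomb b c \notin X) ->
    size (slice T b x) = 4%N.
  move=> hx; apply/eqP; rewrite eqn_leq (leq_size_slice addxx pentT maxT hx) /=.
  have := card_X_gt0; have := cardT x hx; have := cardG x hx.
  (* Density 17/64 means at least 8.5, hence 9, of the 32 cosets of X; five of them lie in V + X. *)
  have arith (g t s k : nat) : (17 * g <= 64 * t -> g = 32 * k ->
    t = (5 + s) * k -> 0 < k -> 4 <= s)%N by nia.
  exact: arith dens.
split; first exact: cardG hx0.
have [a ha] := slice_canon addxx pentT maxT (size_sl _ hx0).
set x := x0 + lincomb b a => cx.
have hx c : c \in codes 4 -> x + lincomb b c \notin X.
  by move=> hc; rewrite -addrA -lincomb_lxor // hx0 // codes_lxor.
have fr5 := index2_frame hx.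
have sz5 : size (rcons b x) = 5%N by rewrite size_rcons sz_b.
have hi5 : (#|G| <= 2 ^ size (rcons b x) * #|X|)%N by rewrite sz5.
have TE := max_blowup addxx sz_b pentT maxT dens fr5 hi5.
set M := filter _ _ in TE.
have ME : M = glue (slices2 (slice T b x)).
  by rewrite /M sz5 (glue_index2 addxx sz_b pentT maxT dens).
have uM : uniq M by rewrite filter_uniq ?codes_uniq.
have sM : {subset M <= codes (size (rcons b x))}.
  by move=> c; rewrite mem_filter => /andP[].
have := allP slices_index2 _ cx; case/orP => [hp|/andP[/eqP hE /allP hQ]]; [left|right].
  apply: (pent_map_max fr5) => //; first by rewrite sz5.
  move=> c hc cT; have : c \in M by rewrite mem_filter cT.
  rewrite ME; apply: glue_pent => h.
  by rewrite !inE => /or4P[] /eqP ->.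
split.
- by rewrite (cardT x hx) size_sl.
- rewrite {1}TE energy_blowup // (code_energyE uM sM) [LHS]mulnC.
  by congr (_ * _)%N; rewrite sz5 ME.
move=> s; rewrite {1}TE inE => /hasP[c cM sX].
have -> : s = lincomb (rcons b x) c + (s + lincomb (rcons b x) c).
  by rewrite addrC (addxK addxx).
rewrite {1}TE quads_blowup ?sM // mulnC leq_mul2r; apply/orP; right.
by rewrite ME in cM *; rewrite code_quadsE hQ.
Qed.

(** At least 17 of the 64 cosets of X lie in [T]; V + X accounts for 5 and the other three slices
    for at most 4 each, so equality holds everywhere. *)
Lemma index4_sizes x y : (32 * #|X| < #|G|)%N ->
  (forall c, c \in codes 4 -> x + lincomb b c \notin X) ->
  (forall c, c \in codes 5 -> y + lincomb (rcons b x) c \notin X) ->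
  [/\ frame (rcons (rcons b x) y) X, #|G| = (64 * #|X|)%N,
     size (slice T b x) = 4%N, size (slice T b y) = 4%N
   & size (slice T b (x + y)) = 4%N].
Proof.
move=> lo hx hy; have fr5 := index2_frame hx.
have fr6 : frame (rcons (rcons b x) y) X.
  by apply: frame_rcons; rewrite ?size_rcons ?sz_b.
have hi := shifts_dens addxx sz_b pentT maxT dens.
have cardG : #|G| = (64 * #|X|)%N.
  apply/eqP; rewrite eqn_leq hi /=.
  by have := frame_card addxx fr6; rewrite !size_rcons sz_b.
have low c : c \in codes 4 -> lincomb (rcons b x) c = lincomb b c.
  by rewrite -sz_b; apply: lincomb_rcons_low.
have x16 : lincomb (rcons b x) 16 = x.
  by rewrite -[RHS](lincomb_rcons_top b x) sz_b.
have hy4 c : c \in codes 4 -> y + lincomb b c \notin X.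
  by move=> hc; rewrite -low // hy //; apply: codes_leq hc.
have hxy c : c \in codes 4 -> x + y + lincomb b c \notin X.
  move=> hc; rewrite (addrC x) -addrA.
  have -> : x + lincomb b c = lincomb (rcons b x) (N.lxor 16 c).
    by rewrite lincomb_lxor // x16 low.
  by apply: hy; apply: codes_lxor; [|apply: codes_leq hc].
have lx := leq_size_slice addxx pentT maxT hx.
have ly := leq_size_slice addxx pentT maxT hy4.
have lxy := leq_size_slice addxx pentT maxT hxy.
have cardT : #|T| = ((5 + size (slice T b x) + size (slice T b y) +
    size (slice T b (x + y)%R)) * #|X|)%N.
  rewrite {1}(max_blowup addxx sz_b pentT maxT dens fr6); last first.
    by rewrite !size_rcons sz_b.
  rewrite !size_rcons sz_b card_blowup ?filter_uniq ?codes_uniq //.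
    by rewrite (glue_index4 addxx sz_b pentT maxT dens) size_glue.
  by move=> c; rewrite mem_filter !size_rcons sz_b => /andP[].
have arith (g t s1 s2 s3 k : nat) : (17 * g <= 64 * t -> g = 64 * k ->
    t = (5 + s1 + s2 + s3) * k -> 0 < k -> s1 <= 4 -> s2 <= 4 -> s3 <= 4 ->
    [/\ s1 = 4, s2 = 4 & s3 = 4])%N.
  move=> h1 h2 h3 k0 *; have : (12 <= s1 + s2 + s3)%N by nia.
  by split; lia.
by have [] := arith _ _ _ _ _ _ dens cardG cardT card_X_gt0 lx ly lxy.
Qed.

Lemma indep_disjoint_sums x y :
  slice T b (x + y) \in combs (disjoint_sums (slice T b x) (slice T b y))
    (size (slice T b (x + y))).
Proof.
apply: mem_combs.
have -> : slice T b (x + y) = [seq c <- disjoint_sums (slice T b x) (slice T b y)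
    | x + y + lincomb b c \in T].
  rewrite /disjoint_sums -filter_predI; apply: eq_in_filter => c hc /=.
  case: (boolP (_ \in T)) => //= cT; apply/esym/allP => a; rewrite !mem_filter.
  case/andP=> aT ha; rewrite memNE mem_filter codes_lxor // andbT.
  apply/negP => acT; move/(sum_freeP _): sfT => sf; have /negP := sf _ _ aT acT.
  by rewrite lincomb_lxor // addrACA (addKx addxx).
exact: filter_subseq.
Qed.

Lemma pent_map_index4 : (32 * #|X| < #|G|)%N ->
  #|G| = (64 * #|X|)%N /\
  ((exists L, pent_map T L) \/
   [/\ #|T| = (17 * #|X|)%N, (2273 * #|X| ^ 3 <= energy T)%N &
   exists2 U : {set G}, sum_free U &
      #|U| = (17 * #|X|)%N /\ energy U = (2249 * #|X| ^ 3)%N]).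
Proof.
move=> lo.
have lo4 : (2 ^ size b * #|X| < #|G|)%N.
  by rewrite sz_b; apply: leq_ltn_trans lo; rewrite leq_mul2r orbT.
have lo5 z : (2 ^ size (rcons b z) * #|X| < #|G|)%N by rewrite size_rcons sz_b.
have [x0] := frame_not_span addxx fr lo4; rewrite sz_b => hx0.
have [y1] := frame_not_span addxx (index2_frame hx0) (lo5 x0).
rewrite size_rcons sz_b => hy1.
have [_ _ sx0 _ _] := index4_sizes lo hx0 hy1.
have [a ha] := slice_canon addxx pentT maxT sx0.
set x := x0 + lincomb b a => cx.
have hx c : c \in codes 4 -> x + lincomb b c \notin X.
  by move=> hc; rewrite -addrA -lincomb_lxor // hx0 // codes_lxor.
have [y0] := frame_not_span addxx (index2_frame hx) (lo5 x).
rewrite size_rcons sz_b => hy0.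
have [_ _ _ sy0 _] := index4_sizes lo hx hy0.
have [a' ha'] := slice_canon addxx pentT maxT sy0.
set y := y0 + lincomb b a' => cy.
have low c : c \in codes 4 -> lincomb (rcons b x) c = lincomb b c.
  by rewrite -sz_b; apply: lincomb_rcons_low.
have hy c : c \in codes 5 -> y + lincomb (rcons b x) c \notin X.
  move=> hc; rewrite -addrA -low // -lincomb_lxor // hy0 // codes_lxor //.
  exact: codes_leq ha'.
have [fr6 cardG sx sy sxy] := index4_sizes lo hx hy; split=> //.
set b6 := rcons (rcons b x) y in fr6.
have sz6 : size b6 = 6%N by rewrite !size_rcons sz_b.
have hi6 : (#|G| <= 2 ^ size b6 * #|X|)%N by rewrite sz6 cardG.
have TE := max_blowup addxx sz_b pentT maxT dens fr6 hi6.
set M := filter _ _ in TE.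
have ME : M = glue (slices4 (slice T b x) (slice T b y) (slice T b (x + y))).
  by rewrite /M sz6 (glue_index4 addxx sz_b pentT maxT dens).
have uM : uniq M by rewrite filter_uniq ?codes_uniq.
have sM : {subset M <= codes (size b6)}.
  by move=> c; rewrite mem_filter => /andP[].
have hz := indep_disjoint_sums x y; rewrite sxy in hz.
have := allP (allP (allP slices_index4 _ cx) _ cy) _ hz.
rewrite (indep_slice addxx sfT pentT).
case: ifP => [+ _|_ hE]; [|right].
  rewrite !all_cat => /and3P[px py pxy]; left.
  apply: (pent_map_max fr6) => //; first by rewrite sz6.
  move=> c hc cT; have : c \in M by rewrite mem_filter cT.
  rewrite ME; apply: glue_pent => h.
  rewrite !inE => /or4P[] /eqP ->.
  - by [].
  - exact: px.
  - exact: py.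
  - exact: pxy.
split.
- rewrite {1}TE card_blowup // ME size_glue sx sy sxy //.
- rewrite {1}TE energy_blowup // (code_energyE uM sM) mulnC leq_mul2l.
  apply/orP; right; rewrite sz6 ME code_energy_glue //.
  by apply: slices4_codes; apply: slice_codes.
(* The competitor: a sum-free set of the same size as [T] with less energy. *)
exists (blowup b6 X pent17).
  apply: (sum_free_blowup addxx fr6 _ sum_free_pent17).
  by rewrite sz6; apply: pent17_codes.
have u17 : uniq pent17 by apply: filter_uniq; apply: codes_uniq.
have s17 : {subset pent17 <= codes (size b6)} by rewrite sz6; apply: pent17_codes.
rewrite card_blowup // energy_blowup // (code_energyE u17 s17) sz6 energy_pent17.
by split; rewrite // mulnC.
Qed.

End Contained.

(** * Sum-free sets with the fewest words of length 4 *)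

Lemma pent_mapS (G : finZmodType) (S T : {set G}) L :
  S \subset T -> pent_map T L -> pent_map S L.
Proof. by move=> /subsetP sub [h1 h2 h3 h4]; split=> // s /sub/h4. Qed.

Section Minimal.
Variable G : finZmodType.
Hypothesis addxx : forall x : G, x + x = 0.
Variables (b0 : seq G) (X0 : {set G}) (k : nat).
Hypothesis sz_b0 : size b0 = 4%N.
Hypothesis fr0 : frame b0 X0.
Hypothesis cardX0 : #|X0| = (2 * k)%N.
Hypothesis cardG : #|G| = (32 * k)%N.

Let k_gt0 : (0 < k)%N.
Proof.
have : (0 < #|G|)%N by apply/card_gt0P; exists 0.
by rewrite cardG muln_gt0.
Qed.

Let P := blowup b0 X0 pent.

Lemma sum_free_ref : sum_free P.
Proof.
apply: (sum_free_blowup addxx fr0 _ sum_free_pent).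
by rewrite sz_b0; apply: pent_codes.
Qed.

Lemma card_ref : #|P| = (10 * k)%N.
Proof.
rewrite card_blowup // ?cardX0 ?sz_b0; first by rewrite mulnA.
exact: pent_codes.
Qed.

Lemma words4_ref : (520 * k ^ 3 + 20 * k = 24 * #|words4 P| + 300 * k ^ 2)%N.
Proof.
have s4 : {subset pent <= codes (size b0)} by rewrite sz_b0; apply: pent_codes.
have := energy_words4 addxx P; rewrite energy_blowup // (code_energyE _ s4) //.
rewrite card_ref cardX0 sz_b0 energy_pent !expnMn => h.
by clear -h; lia.
Qed.

Variable S : {set G}.
Hypothesis sfS : sum_free S.
Hypothesis lo : (17 * #|G| <= 64 * #|S|)%N.
Hypothesis hi : (16 * #|S| <= 5 * #|G|)%N.
Hypothesis minS : forall S' : {set G}, sum_free S' -> #|S'| = #|S| ->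
  (#|words4 S| <= #|words4 S'|)%N.

Let lo' : (17 * k <= 2 * #|S|)%N.
Proof. by move: lo; rewrite cardG; lia. Qed.

Let hi' : (#|S| <= 10 * k)%N.
Proof. by move: hi; rewrite cardG; lia. Qed.

(** Compare [S] with a subset of [P] of the same size that has at most its proportional share of
    words. *)
Lemma words4_min : (#|words4 S| * (10 * k) ^ 4 <= #|words4 P| * #|S| ^ 4)%N.
Proof.
have le_n : (#|S| <= #|P|)%N by rewrite card_ref.
have [S' /andP[sub /eqP cS'] hS'] := words4_subset le_n.
rewrite card_ref in hS'; apply: leq_trans hS'; rewrite leq_mul2r; apply/orP; right.
by apply: minS cS'; apply: sum_freeS sub sum_free_ref.
Qed.

Lemma exists_pentagon : exists b : seq G, size b = 4%N /\
  {in pent, forall e, lincomb b e \in S}.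
Proof.
have := energy_bound k_gt0 lo' hi' words4_ref words4_min (energy_words4 addxx S).
rewrite -cardG => hE.
pose Q (p : G * G * G * G * G) := let: (a, b, c, d, e) := p in
  [&& a + b + c + d + e == 0, a \in S, b \in S, c \in S, d \in S & e \in S].
have [/existsP[[[[[a b] c] d] e]]|] := boolP [exists p, Q p].
  case/and5P=> /eqP sum aS bS cS /andP[dS eS]; exists [:: a; b; c; d].
  by split=> //; apply: sum_free_pentagon sum _ _ _ _ _.
rewrite negb_exists => /forallP nQ; have := energy_no_pentagon addxx sfS.
move=> h; suff /h : forall a b c d e, a \in S -> b \in S -> c \in S -> d \in S ->
    e \in S -> a + b + c + d + e != 0 by rewrite leqNgt hE.
move=> a b c d e aS bS cS dS eS; have := nQ (a, b, c, d, e).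
by rewrite /Q aS bS cS dS eS !andbT.
Qed.

Theorem exists_pent_map : exists L, pent_map S L.
Proof.
have [b [sz_b pentS]] := exists_pentagon.
have [T maxT sub] := maxset_exists sfS.
suff : exists L, pent_map T L by case=> L /(pent_mapS sub); exists L.
have leT : (#|S| <= #|T|)%N by apply: subset_leq_card.
have pentT : {in pent, forall e, lincomb b e \in T}.
  by move=> e /pentS; apply: (subsetP sub).
have dens : (17 * #|G| <= 64 * #|T|)%N.
  by apply: leq_trans lo _; rewrite leq_mul2l leT orbT.
set X := shifts T b.
have [h1|h1] := leqP #|G| (16 * #|X|).
  exact: (pent_map_index1 addxx sz_b pentT maxT dens h1).
have [h2|h2] := leqP #|G| (32 * #|X|).
  have [cG [//|[cT eT qT]]] := pent_map_index2 addxx sz_b pentT maxT dens h1 h2.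
  exfalso; have kX : #|X| = k.
    by move: cG; rewrite -/X cardG; move: #|X| => x; clear; lia.
  rewrite -/X kX in cT eT qT.
  (* The largest number of words through a point that [quads_words4] allows when |T| = 9 k and each
     point has at most 49 k^2 quads. *)
  pose D := ((49 * k ^ 2 + 2 - 27 * k) %/ 6)%N.
  have hd s : s \in T -> (#|[set W in words4 T | s \in W]| <= D)%N.
    move=> sT; have := quads_words4 addxx sT; have := qT s sT; rewrite cT /D.
    set w := #|_|; set q := quads _ _; rewrite leq_divRL //; clear; lia.
  have hT := words4_sub_lb sub hd; rewrite cT in hT.
  apply: (index2_contra k_gt0 lo' _ _ hT _ words4_ref words4_min).
  - by rewrite -cT.
  - have := energy_words4 addxx T; rewrite cT eT; clear; lia.
  - have : (6 * D <= 49 * k ^ 2 + 2 - 27 * k)%N by rewrite mulnC leq_divM.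
    by have : (27 * k <= 49 * k ^ 2 + 2)%N; [clear -k_gt0; nia | clear; lia].
have [cG [//|[cT eT [U sfU [cU eU]]]]] := pent_map_index4 addxx sz_b pentT maxT dens h2.
exfalso; rewrite -/X in cG cT eT cU eU.
(* Here [T] has density exactly 17/64, the least that [S] may have, so [S] is all of [T]. *)
have cS : #|S| = #|T|.
  apply/eqP; rewrite eqn_leq leT cT /=; move: lo; rewrite cG.
  by move: #|X| #|S| => x n; clear; lia.
have TS : S = T by apply/eqP; rewrite eqEcard sub cS leqnn.
have := minS sfU; rewrite cU cS cT => /(_ erefl) hU.
have := energy_words4 addxx U; have := energy_words4 addxx T.
rewrite cT cU eU; rewrite TS in hU.
have X0' : (0 < #|X| ^ 3)%N by rewrite expn_gt0; apply/orP; left; apply: (card_X_gt0 pentT).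
move: (#|X| ^ 3)%N X0' eT => x3; move: (#|X|) => x.
move: (energy T) #|words4 T| #|words4 U| hU => e w u; clear; lia.
Qed.

End Minimal.

(** * Designs *)

Lemma addF2 (c : 'F_2) : c + c = 0.
Proof. by rewrite -mulr2n -mulr_natl pchar_Zp ?mul0r. Qed.

Lemma F2E (c : 'F_2) : c = (c != 0)%:R.
Proof. by case: c => [[|[|//]] ?]; apply/val_inj. Qed.

Lemma addrV2 m n (v : 'M['F_2]_(m, n)) : v + v = 0.
Proof. by apply/matrixP => i j; rewrite !mxE addF2. Qed.

Definition design_of (N n k : nat) (a : 'I_n -> 'rV['F_2]_k)
    (x : 'I_N -> 'rV['F_2]_k) : 'M['F_2]_(N, n) :=
  \matrix_(i, j) (a j *m (x i)^T) 0 0.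

Lemma dotE k (u v : 'rV['F_2]_k) : (u *m v^T) 0 0 = \sum_(l < k) u 0 l * v 0 l.
Proof. by rewrite mxE; apply: eq_bigr => l _; rewrite mxE. Qed.

Lemma regular_design_of N n k (a : 'I_n -> 'rV['F_2]_k) (x : 'I_N -> 'rV['F_2]_k) :
  bijective x -> regular (design_of a x).
Proof. by move=> bij_x; exists k, a, x; split=> // i j; rewrite mxE dotE. Qed.

Section Words.
Variables (N n k : nat) (x : 'I_N -> 'rV['F_2]_k).
Hypothesis bij_x : bijective x.

Lemma sum_col_eq0 (a : 'I_n -> 'rV['F_2]_k) (J : {set 'I_n}) :
  (\sum_(j in J) col j (design_of a x) == 0) = (\sum_(j in J) a j == 0).
Proof.
have entryE i : (\sum_(j in J) col j (design_of a x)) i 0 =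
    ((\sum_(j in J) a j) *m (x i)^T) 0 0.
  by rewrite summxE mulmx_suml summxE; apply: eq_bigr => j _; rewrite [LHS]mxE [LHS]mxE.
apply/eqP/eqP => [h|h]; last first.
  by apply/matrixP => i j; rewrite ord1 entryE h mul0mx !mxE.
(* The runs include every unit vector, and these read off the coordinates of the sum. *)
have [y xK yK] := bij_x; apply/rowP => l.
have := entryE (y (delta_mx 0 l)).
by rewrite h yK trmx_delta -colE !mxE => <-.
Qed.

Lemma num_wordsE (a : 'I_n -> 'rV['F_2]_k) i : num_words (design_of a x) i.+1 =
  #|[set J : {set 'I_n} | (\sum_(j in J) a j == 0) && (#|J| == i.+1)]|.
Proof.
apply: eq_card => J; rewrite !inE /defining_word sum_col_eq0 -card_gt0.
by have [->|_] := eqVneq #|J| i.+1; rewrite ?andbF ?andbT.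
Qed.

End Words.

(** Reduces lexicographic minimality to a comparison of A_4 once the competitor has A_1 = A_2 = A_3
    = 0. *)
Lemma pattern_le n (t1 t2 : n.-tuplelexi nat) (i : 'I_n) : (t1 <= t2)%O ->
  (forall j : 'I_n, (j < i)%N -> tnth t2 j = 0%N) ->
  (forall j : 'I_n, (j < i)%N -> tnth t1 j = 0%N) /\ (tnth t1 i <= tnth t2 i)%N.
Proof.
case/lexi_tupleP=> m hm h0.
have le_im : (i <= m)%N.
  rewrite leqNgt; apply/negP => lt_mi; have lt_mn := ltn_trans lt_mi (ltn_ord i).
  have := hm (Ordinal lt_mn) (leqnn _); rewrite /= eqxx h0 //= => -[h1 h2].
  by move: h1 h2; rewrite leEnat leqn0 => ->.
split=> [j lt_ji|]; last by have [] := hm i le_im.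
have [+ _] := hm j (ltnW (leq_trans lt_ji le_im)).
by rewrite h0 // leEnat leqn0 => /eqP.
Qed.

Section ZeroSums.
Variables (n k : nat) (a : 'I_n -> 'rV['F_2]_k).

Definition zero_sums (i : nat) : {set {set 'I_n}} :=
  [set J : {set 'I_n} | (\sum_(j in J) a j == 0) && (#|J| == i)].

Lemma zero_sums_sum_free : zero_sums 1 = set0 -> zero_sums 2 = set0 ->
  zero_sums 3 = set0 -> injective a /\ sum_free (a @: setT).
Proof.
move=> z1 z2 z3.
have nz (J : {set _}) i : zero_sums i = set0 -> #|J| = i -> \sum_(j in J) a j != 0.
  move=> zi cJ; apply/negP => /eqP h.
  have : J \in zero_sums i by rewrite inE h cJ !eqxx.
  by rewrite zi inE.
have a0 j : a j != 0 by have := nz [set j] _ z1; rewrite big_set1 cards1; apply.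
have a_inj : injective a.
  move=> i j eq_a; apply/eqP; apply: contraT => ij.
  have := nz [set i; j] _ z2; rewrite cards2 ij => /(_ erefl).
  by rewrite big_setU1 ?inE //= big_set1 eq_a addrV2 eqxx.
split=> //; apply/sum_freeP => _ _ /imsetP[i _ ->] /imsetP[j _ ->].
apply/imsetP => -[l _ E].
have [ij|ij] := eqVneq i j.
  by move: (a0 l); rewrite -E ij addrV2 eqxx.
have [jl|jl] := eqVneq j l.
  by move: (a0 i); rewrite -[a i](addxK (@addrV2 _ _) _ (a j)) E jl addrV2 eqxx.
have [il|il] := eqVneq i l.
  by move: (a0 j); rewrite -[a j](addKx (@addrV2 _ _) (a i)) E il addrV2 eqxx.
have := nz [set i; j; l] _ z3; rewrite -setUA !cardsU1 cards1 !inE negb_or ij il jl.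
move=> /(_ erefl); rewrite !big_setU1 ?inE ?negb_or ?ij ?il ?jl //= big_set1.
by rewrite addrA E addrV2 eqxx.
Qed.

Hypothesis a_inj : injective a.

Lemma zero_sums_eq0 i : sum_free (a @: setT) -> (0 < i < 4)%N -> zero_sums i = set0.
Proof.
move=> sf hi; apply/setP => J; rewrite !inE; apply/negP => /andP[/eqP sum /eqP cJ].
have aS j : a j \in a @: setT by apply: imset_f.
have {}sf := sum_freeP _ sf.
case: i hi cJ => [|[|[|[|i]]]] // _ cJ.
- have /cards1P[j E] : #|J| == 1%N by rewrite cJ.
  move: sum; rewrite E big_set1 => a0; have := sf _ _ (aS j) (aS j).
  by rewrite a0 addr0 -a0 aS.
- have /cards2P[j [l [jl E]]] : #|J| == 2%N by rewrite cJ.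
  move: sum; rewrite E big_setU1 ?inE //= big_set1 => /eqP.
  by rewrite (addx_eq0 (@addrV2 _ _)) => /eqP/a_inj/eqP; rewrite (negbTE jl).
- have [j jJ] : exists j, j \in J by apply/set0Pn; rewrite -card_gt0 cJ.
  have /cards2P[l [m [lm E]]] : #|J :\ j| == 2%N.
    by have := cardsD1 j J; rewrite jJ cJ add1n => -[<-].
  move: sum; rewrite (big_setD1 j) //= E big_setU1 ?inE //= big_set1 => /eqP.
  rewrite addrC (addx_eq0 (@addrV2 _ _)) => /eqP sum.
  by have := sf _ _ (aS l) (aS m); rewrite sum aS.
Qed.

Lemma card_zero_sums4 : #|zero_sums 4| = #|words4 (a @: setT)|.
Proof.
rewrite -(card_imset _ (imset_inj a_inj)); apply: eq_card => W.
apply/imsetP/idP => [[J + ->]|].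
  rewrite !inE => /andP[/eqP sum /eqP cJ].
  rewrite imsetS ?subsetT // card_imset // cJ big_imset /= ?sum ?eqxx // => ? ? _ _.
  exact: a_inj.
rewrite inE => /and3P[/subsetP sub /eqP cW /eqP sW].
have WE : W = a @: [set j | a j \in W].
  apply/setP => w; apply/idP/imsetP => [wW|[j + ->]]; last by rewrite inE.
  by have /imsetP[j _ wE] := sub _ wW; exists j => //; rewrite inE -wE.
exists [set j | a j \in W] => //; rewrite inE.
rewrite -(card_imset _ a_inj) -WE cW eqxx andbT -[X in _ == X]sW.
by rewrite {2}WE big_imset //= => ? ? _ _; apply: a_inj.
Qed.

End ZeroSums.

Lemma minimum_aberration_words4 N n k (a : 'I_n -> 'rV['F_2]_k)
    (x : 'I_N -> 'rV['F_2]_k) (S0 : {set 'rV['F_2]_k}) :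
  bijective x -> minimum_aberration (design_of a x) -> (3 < n)%N ->
  sum_free S0 -> #|S0| = n ->
  [/\ injective a, sum_free (a @: setT)
    & forall S' : {set 'rV['F_2]_k}, sum_free S' -> #|S'| = n ->
        (#|words4 (a @: setT)| <= #|words4 S'|)%N].
Proof.
move=> bij_x [_ minD] n4 sf0 cS0.
have main (S' : {set 'rV['F_2]_k}) : sum_free S' -> #|S'| = n ->
    [/\ zero_sums a 1 = set0, zero_sums a 2 = set0, zero_sums a 3 = set0
      & (#|zero_sums a 4| <= #|words4 S'|)%N].
  move=> sfS' cS'; pose a' j := enum_val (cast_ord (esym cS') j).
  have inj_a' : injective a' by move=> i j /enum_val_inj/cast_ord_inj.
  have im_a' : a' @: setT = S'.
    apply/eqP; rewrite eqEcard card_imset // cardsT card_ord cS' leqnn andbT.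
    by apply/subsetP => _ /imsetP[j _ ->]; apply: enum_valP.
  have := minD _ (regular_design_of a' bij_x).
  (* Entry 3 of the pattern is A_4. *)
  pose i3 : 'I_n := Ordinal n4 => /(@pattern_le _ _ _ i3).
  have z' i : (0 < i < 4)%N -> zero_sums a' i = set0.
    by apply: zero_sums_eq0 inj_a' _ _; rewrite im_a'.
  case=> [j ltj|h0 h3].
    by rewrite tnth_mktuple num_wordsE // -/(zero_sums a' j.+1) z' ?cards0.
  have z i : (i < 3)%N -> zero_sums a i.+1 = set0.
    move=> lti; have := h0 (Ordinal (ltn_trans lti n4)) lti.
    by rewrite tnth_mktuple num_wordsE // => /cards0_eq.
  split; [exact: z|exact: z|exact: z|].
  move: h3; rewrite !tnth_mktuple !num_wordsE // -!/(zero_sums _ _).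
  by rewrite (card_zero_sums4 inj_a') im_a'.
have [z1 z2 z3 _] := main S0 sf0 cS0.
have [inj_a sf] := zero_sums_sum_free z1 z2 z3; split=> // S' sfS' cS'.
by rewrite -(card_zero_sums4 inj_a); have [] := main S' sfS' cS'.
Qed.

Definition code_row (c : N) : 'rV['F_2]_4 :=
  \row_l (N.testbit c (N.of_nat l))%:R.

Lemma code_row_lxor c d : code_row (N.lxor c d) = code_row c + code_row d.
Proof.
apply/rowP => l; rewrite !mxE N.lxor_spec.
by do 2!case: N.testbit; apply/val_inj.
Qed.

Lemma code_row_inj : {in codes 4 &, injective code_row}.
Proof.
move=> c d hc hd /rowP h; apply: N.bits_inj => i.
have [lt4|le4] := ltnP (N.to_nat i) 4; last first.
  by rewrite -[i]N2Nat.id !(testbit_codes _ le4).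
have := h (Ordinal lt4); rewrite !mxE /= N2Nat.id.
by do 2!case: N.testbit.
Qed.

Lemma code_row_surj (v : 'rV['F_2]_4) : exists2 c, c \in codes 4 & code_row c = v.
Proof.
have hc (i : 'I_(2 ^ 4)) : N.of_nat i \in codes 4 by rewrite mem_codes Nat2N.id.
have inj : injective (fun i : 'I_(2 ^ 4) => code_row (N.of_nat i)).
  by move=> i j /(code_row_inj (hc i) (hc j))/Nat2N.inj/ord_inj.
have cT : (#|{: 'rV['F_2]_4}| <= #|'I_(2 ^ 4)|)%N by rewrite card_mx card_Fp // card_ord.
have [g _ gK] := inj_card_bij inj cT.
by exists (N.of_nat (g v)).
Qed.

(** * The reference design in coordinates *)

Section Reference.
Variable s : nat.

(** With [ref_comp] as subgroup, the blowup of [pent] consists of the vectors whose last four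
    coordinates form a pentagon element. *)
Definition ref_basis : seq 'rV['F_2]_(s + 4) :=
  [seq row_mx 0 (delta_mx 0 l) | l <- enum 'I_4].

Definition ref_comp : {set 'rV['F_2]_(s + 4)} := [set v | rsubmx v == 0].

Lemma size_ref_basis : size ref_basis = 4%N.
Proof. by rewrite size_map size_enum_ord. Qed.

Lemma rsubmx_lincomb_ref c : rsubmx (lincomb ref_basis c) = code_row c.
Proof.
apply/rowP => l; rewrite !mxE /lincomb summxE size_ref_basis.
rewrite (bigD1 l) //= big1 ?addr0 => [|i il].
  rewrite (nth_map l) ?size_enum_ord // nth_ord_enum.
  by case: N.testbit; rewrite ?row_mxEr !mxE ?eqxx.
rewrite (nth_map l) ?size_enum_ord // nth_ord_enum.
by case: N.testbit; rewrite ?row_mxEr !mxE // eq_sym (negbTE il).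
Qed.

Lemma frame_ref : frame ref_basis ref_comp.
Proof.
split=> [|u v|c]; rewrite ?inE ?linear0 //.
  move=> /eqP hu /eqP hv; apply/eqP/rowP => l.
  by move/rowP/(_ l): hu; move/rowP/(_ l): hv; rewrite !mxE => -> ->; rewrite addr0.
rewrite size_ref_basis rsubmx_lincomb_ref => hc /eqP h.
apply: code_row_inj => //.
by rewrite h; apply/rowP => l; rewrite !mxE N.bits_0.
Qed.

Lemma card_ref_comp : #|ref_comp| = (2 ^ s)%N.
Proof.
have inj : injective (fun u : 'rV['F_2]_s => row_mx u (0 : 'rV['F_2]_4)).
  by move=> u v /eq_row_mx[].
have <- : #|[set: 'rV['F_2]_s]| = (2 ^ s)%N by rewrite cardsT card_mx card_Fp // mul1n.
rewrite -(card_imset _ inj); apply: eq_card => v; rewrite inE.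
apply/eqP/imsetP => [h|[u _ ->]]; last by rewrite row_mxKr.
by exists (lsubmx v) => //; rewrite -h hsubmxK.
Qed.

End Reference.

(* Doubling prepends a coordinate, so the pentagon sits in the last four.     *)
Definition pent_coords (N n s : nat) (Y : 'M['F_2]_(N, n))
    (row_of : 'I_N -> 'rV['F_2]_(s + 4)) (col_of : 'I_n -> 'rV['F_2]_(s + 4)) : Prop :=
  [/\ bijective row_of, Y = design_of col_of row_of
    & forall v, (exists2 c, c \in pent & rsubmx v = code_row c) ->
        exists j, col_of j = v].

Lemma pent_coords_castmx N n N' n' s (eqN : N = N') (eqn : n = n')
    (Y : 'M['F_2]_(N, n)) row_of col_of :
  @pent_coords _ _ s Y row_of col_of ->
  exists row_of' col_of', @pent_coords N' n' s (castmx (eqN, eqn) Y) row_of' col_of'.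
Proof. by case: _ / eqN; case: _ / eqn => h; exists row_of, col_of; rewrite castmx_id. Qed.

Lemma pent_coords_double N n s (Y : 'M['F_2]_(N, n)) row_of col_of :
  @pent_coords _ _ s Y row_of col_of ->
  exists row_of' col_of', @pent_coords _ _ s.+1 (double_design Y) row_of' col_of'.
Proof.
case=> bij_row YE col_surj.
(* The new coordinate marks the half, for runs and columns alike; the product of two marks is 1 only
   in the lower right block, where doubling adds 1. *)
pose row' (i : 'I_(N + N)) : 'rV['F_2]_(1 + (s + 4)) :=
  match split i with
  | inl i0 => row_mx 0 (row_of i0) | inr i0 => row_mx (const_mx 1) (row_of i0) end.
pose col' (j : 'I_(n + n)) : 'rV['F_2]_(1 + (s + 4)) :=
  match split j with
  | inl j0 => row_mx 0 (col_of j0) | inr j0 => row_mx (const_mx 1) (col_of j0) end.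
exists row', col'; split.
- have inj : injective row'.
    have inj_row := bij_inj bij_row.
    move=> i j; rewrite /row' -{2}(splitK i) -{2}(splitK j).
    case: (split i) => i0; case: (split j) => j0 /eq_row_mx[h1 /inj_row ->] //.
    + by move/rowP/(_ 0): h1; rewrite !mxE.
    + by move/rowP/(_ 0): h1; rewrite !mxE.
  apply: (inj_card_bij inj); rewrite card_mx card_Fp // card_ord.
  have := bij_eq_card bij_row; rewrite card_mx card_Fp // card_ord !mul1n => ->.
  by rewrite expnS addnn mul2n.
- apply/matrixP => i j; rewrite [RHS]mxE /row' /col' -{1}(splitK i) -{1}(splitK j).
  have Y0 i0 j0 : Y i0 j0 = (col_of j0 *m (row_of i0)^T) 0 0 by rewrite YE mxE.
  have dot (p q : 'rV['F_2]_1) (u v : 'rV['F_2]_(s + 4)) :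
      ((row_mx p u : 'rV_(s.+1 + 4)) *m (row_mx q v : 'rV_(s.+1 + 4))^T) 0 0 =
      p 0 0 * q 0 0 + (u *m v^T) 0 0.
    transitivity ((row_mx p u *m (row_mx q v)^T) 0 0) => //.
    by rewrite tr_row_mx mul_row_col mxE; congr (_ + _); rewrite mxE big_ord1 mxE.
  case: (split i) => i0; case: (split j) => j0 /=; rewrite dot -Y0 /double_design.
  + by rewrite block_mxEul [X in X * _]mxE mul0r add0r.
  + by rewrite block_mxEur [X in _ * X]mxE mulr0 add0r.
  + by rewrite block_mxEdl [X in X * _]mxE mul0r add0r.
  + by rewrite block_mxEdr !mxE mulr1 addrC.
- move=> v [c hc hv]; pose w : 'rV['F_2]_(1 + (s + 4)) := v.
  have [j0 hj0] : exists j0, col_of j0 = rsubmx w.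
    apply: col_surj; exists c => //; rewrite -hv; apply/rowP => l; rewrite !mxE.
    by congr (v _ _); apply/val_inj.
  have wE : w = row_mx (lsubmx w) (rsubmx w) by rewrite hsubmxK.
  have lwE : lsubmx w = const_mx (lsubmx w 0 0).
    by apply/rowP => l; rewrite ord1 [RHS]mxE.
  case h : (lsubmx w 0 0 == 0).
    exists (lshift n j0); rewrite /col' -[lshift n j0]/(unsplit (inl j0)) unsplitK hj0.
    by apply: etrans (esym wE); rewrite lwE (eqP h).
  exists (rshift n j0); rewrite /col' -[rshift n j0]/(unsplit (inr j0)) unsplitK hj0.
  by apply: etrans (esym wE); rewrite lwE [lsubmx w 0 0]F2E h.
Qed.

Lemma pent_coords_even :
  exists row_of col_of, @pent_coords _ _ 0 even_design row_of col_of.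
Proof.
(* An even vector is determined by its first four entries; the fifth is their sum, which is the
   product with the code 15. *)
pose row_of (i : 'I_16) : 'rV['F_2]_(0 + 4) :=
  lsubmx (enum_val (cast_ord (esym card_even_vectors) i) : 'rV['F_2]_(4 + 1)).
pose col_of (j : 'I_5) : 'rV['F_2]_(0 + 4) := code_row (nth 0%num pent j).
have even i : \sum_j even_design i j = 0.
  have := enum_valP (cast_ord (esym card_even_vectors) i).
  rewrite mem_even_vectors => /eqP sum0; rewrite -[RHS]sum0.
  by apply: eq_bigr => j _; rewrite mxE.
have rowE i (l : 'I_4) : row_of i 0 l = even_design i (lshift 1 l).
  by rewrite !mxE.
have last_even i : even_design i (rshift 4 ord0) = \sum_(l < 4) row_of i 0 l.
  have := even i; rewrite (@big_split_ord _ _ _ 4 1) /= big_ord1 => /eqP.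
  rewrite (addx_eq0 addF2) => /eqP <-.
  by apply: eq_bigr => l _; rewrite rowE.
have bit_basis (l l' : 'I_4) :
    N.testbit (nth 0%num pent l) (N.of_nat l') = (l' == l).
  by case: l l' => [[|[|[|[|//]]]] ?] [[|[|[|[|//]]]] ?].
have bit_sum (l : 'I_4) : N.testbit (nth 0%num pent 4) (N.of_nat l).
  by case: l => [[|[|[|[|//]]]] ?].
have entry i j : even_design i j = (col_of j *m (row_of i)^T) 0 0.
  rewrite dotE; case: (@split_ordP 4 1 j) => l ->; last first.
    rewrite ord1 last_even; apply: eq_bigr => l' _.
    by rewrite [col_of _ _ _]mxE bit_sum mul1r.
  rewrite (bigD1 l) //= big1 ?addr0 => [|l' l'l].
    by rewrite [col_of _ _ _]mxE bit_basis eqxx mul1r rowE.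
  by rewrite [col_of _ _ _]mxE bit_basis (negbTE l'l) mul0r.
exists row_of, col_of; split.
- have inj : injective row_of.
    move=> i i' h; have E j : even_design i j = even_design i' j.
      by rewrite !entry h.
    apply: (@cast_ord_inj _ _ (esym card_even_vectors)); apply: enum_val_inj.
    by apply/rowP => j; have := E j; rewrite !mxE.
  by apply: (inj_card_bij inj); rewrite card_mx card_Fp // card_ord.
- by apply/matrixP => i j; rewrite entry [RHS]mxE.
- move=> v [c hc hv]; have lt5 : (index c pent < 5)%N by rewrite (index_mem c pent).
  exists (Ordinal lt5); rewrite /col_of nth_index // -hv; apply/rowP => l.
  by rewrite mxE; congr (v _ _); apply/val_inj.
Qed.

Lemma pent_coords_iter t :
  exists row_of col_of, @pent_coords _ _ t (iter_double t even_design) row_of col_of.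
Proof.
elim: t => [|t [row_of [col_of IH]]] /=.
  have [row_of [col_of h]] := pent_coords_even; exact: pent_coords_castmx h.
have [row' [col' h]] := pent_coords_double IH; exact: pent_coords_castmx h.
Qed.

(** * Change of coordinates and the final isomorphism *)

Lemma complete_unitmx (F : fieldType) s m (M : 'M[F]_(s + m, m)) :
  row_full M -> exists2 A : 'M_(s + m), A \in unitmx & rsubmx A = M.
Proof.
move=> fullM; have [B BM] := row_fullP fullM.
have [K freeK KM] : exists2 K : 'M_(s, s + m), row_free K & K *m M = 0.
  have rk : \rank (kermx M) = s.
    by rewrite mxrank_ker; move: fullM => /eqP ->; rewrite addnK.
  have h : row_free (row_base (kermx M)) by apply: row_base_free.
  have h' : row_base (kermx M) *m M = 0.
    by apply/sub_kermxP; rewrite eq_row_base.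
  by move: (row_base (kermx M)) h h'; rewrite rk => K; exists K.
(* [K] spans the left kernel of [M] and [B] is a left inverse of [M], so [C *m M] is zero above the
   identity, and the last columns of [invmx C] are those of [M]. *)
pose C := col_mx K B.
have CM : C *m M = col_mx 0 1%:M by rewrite mul_col_mx KM BM.
have unitC : C \in unitmx.
  rewrite -row_free_unit; apply/inj_row_free => v.
  rewrite -[v]hsubmxK mul_row_col => vC.
  have v0 : rsubmx v = 0.
    have := congr1 (mulmx^~ M) vC.
    by rewrite /= mulmxDl -!mulmxA KM BM mulmx0 add0r mulmx1 mul0mx.
  move: vC; rewrite v0 mul0mx addr0 => vK.
  have -> : lsubmx v = 0 by apply: (row_free_inj freeK); rewrite vK mul0mx.
  by rewrite row_mx0.
exists (invmx C); first by rewrite unitmx_inv.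
rewrite -[RHS](mulKmx unitC) CM -{2}[invmx C]hsubmxK mul_row_col.
by rewrite mulmx0 add0r mulmx1.
Qed.

(** An additive map over F_2 is linear; surjectivity makes its matrix of four columns of full rank,
    so it can be completed to an invertible one. *)
Lemma pent_map_matrix s (S : {set 'rV['F_2]_(s + 4)}) L : pent_map S L ->
  exists2 A : 'M['F_2]_(s + 4), A \in unitmx &
    forall v : 'rV_(s + 4), rsubmx (v *m A) = code_row (L v).
Proof.
case=> Ladd _ Lsurj _; pose f v := code_row (L v).
have fD u v : f (u + v) = f u + f v by rewrite /f Ladd code_row_lxor.
have f0 : f 0 = 0 by apply: (addIr (f 0)); rewrite -fD !add0r.
have fZ (c : 'F_2) v : f (c *: v) = c *: f v.
  by rewrite [c]F2E; case: (c != 0); rewrite ?scale1r ?scale0r.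
pose M : 'M['F_2]_(s + 4, 4) := \matrix_(i < s + 4) f (delta_mx 0 i).
have fM v : v *m M = f v.
  rewrite mulmx_sum_row [v in RHS]row_sum_delta.
  have -> : f (\sum_j v 0 j *: delta_mx 0 j) = \sum_j f (v 0 j *: delta_mx 0 j).
    by elim/big_rec2: _ => // j x y _ <-; rewrite fD.
  by apply: eq_bigr => j _; rewrite fZ rowK.
have fullM : row_full M.
  apply/row_fullP; have hg (l : 'I_4) : exists g, f g = delta_mx 0 l.
    by have [c hc <-] := code_row_surj (delta_mx 0 l); have [g gE] := Lsurj c hc;
      exists g; rewrite /f gE.
  have [g hg'] : exists g : 'I_4 -> 'rV['F_2]_(s + 4),
      forall l, f (g l) = delta_mx 0 l.
    have /fin_all_exists := hg; case=> g; by exists g.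
  exists (\matrix_(l < 4) g l); apply/row_matrixP => l.
  by rewrite row_mul rowK fM hg' row1.
have [A uA rA] := complete_unitmx fullM; exists A => // v.
by rewrite -[RHS]fM -rA mulmx_rsub.
Qed.

Local Close Scope ring_scope.

Theorem theorem3 (t N n : nat) (hN : N = 32 * 2 ^ t)
  (hn_lower : 17 * N <= 64 * n) (hn_upper : 16 * n <= 5 * N)
  (D : 'M['F_2]_(N, n)) (hD : minimum_aberration D) :
  exists S : {set 'I_(5 * 2 ^ t.+1)},
    design_iso D (projection (max_resIV_design t) S).
Proof.
have [[k [a [x [bij_x entryD]]]] _] := hD.
have DE : D = design_of a x by apply/matrixP => i j; rewrite entryD mxE dotE.
have kE : k = (t.+1 + 4).
  have := bij_eq_card bij_x; rewrite card_ord card_mx card_Fp // mul1n hN => cN.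
  apply: (@expnI 2) => //; rewrite -cN expnD expnS; lia.
subst k; rewrite {}DE in hD *; clear entryD.
set m := 2 ^ t in hN.
have cX0 : #|ref_comp t.+1| = 2 * m by rewrite card_ref_comp expnS.
have cG : #|{: 'rV['F_2]_(t.+1 + 4)}| = 32 * m.
  by rewrite card_mx card_Fp // mul1n addSn expnS expnD /m; lia.
have char2 := @addrV2 1 (t.+1 + 4).
have fr := frame_ref t.+1; have sz := size_ref_basis t.+1.
have cP := card_ref char2 sz fr cX0.
have le_n : n <= #|blowup (ref_basis t.+1) (ref_comp t.+1) pent|.
  by rewrite cP; move: hn_upper; rewrite hN; clear; lia.
have [S0 /andP[sub0 /eqP cS0] _] := words4_subset le_n.
have sf0 := sum_freeS sub0 (sum_free_ref char2 sz fr).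
have n_gt3 : 3 < n.
  have : 0 < m by rewrite expn_gt0.
  by move: hn_lower; rewrite hN; clear; lia.
have [inj_a sfS minS] := minimum_aberration_words4 bij_x hD n_gt3 sf0 cS0.
have cS : #|a @: setT| = n by rewrite card_imset // cardsT card_ord.
have [L hL] : exists L, pent_map (a @: setT) L.
  apply: (exists_pent_map char2 sz fr cX0 cG) => //.
  - by rewrite cG cS -hN.
  - by rewrite cG cS -hN.
  - by move=> S' sfS' cS'; apply: minS; rewrite // cS' cS.
have [A uA rA] := pent_map_matrix hL.
have [row_of [col_of [bij_row maxE col_surj]]] := pent_coords_iter t.+1.
have [f fE] : exists f : 'I_n -> 'I_(5 * 2 ^ t.+1),
    forall j, col_of (f j) = (a j *m A)%R.
  suff /fin_all_exists[f fE] : forall j, exists j', col_of j' = (a j *m A)%R by exists f.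
  move=> j; apply: col_surj; exists (L (a j)) => //.
  by case: hL => _ _ _; apply; apply: imset_f.
have inj_f : injective f.
  by move=> i j fij; apply: inj_a; apply: (can_inj (mulmxK uA)); rewrite -!fE fij.
have [row_inv row_invK rowK] := bij_row.
have fS j : f j \in f @: setT by apply: imset_f.
(* Columns are moved by [A] and runs by its inverse transpose, which leaves all products of a column
   with a run unchanged. *)
exists (f @: setT), (fun i => row_inv (x i *m (invmx A)^T)%R),
  (fun j => enum_rank_in (fS j) (f j)); split.
- suff bij_r : bijective (fun v => row_inv (v *m (invmx A)^T)%R).
    exact: bij_comp bij_r bij_x.
  exists (fun i => row_of i *m A^T)%R => [v|i].
    by rewrite rowK -mulmxA -trmx_mul mulmxV // trmx1 mulmx1.
  by rewrite -mulmxA -trmx_mul mulVmx // trmx1 mulmx1 row_invK.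
- apply: inj_card_bij; last by rewrite !card_ord card_imset // cardsT card_ord.
  move=> i j /(congr1 enum_val); rewrite !enum_rankK_in //; exact: inj_f.
- move=> i j; rewrite [LHS]mxE [RHS]mxE enum_rankK_in // /max_resIV_design maxE.
  by rewrite [RHS]mxE fE rowK trmx_mul trmxK mulmxA mulmxK.
Qed.
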